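(* Let $k \geq 2$ be an integer. For any real numbers $0 < p, \alpha < 1$ there exist $n_0$ and $\mu > 0$ such that if $H$ is an $(n, p, \mu, \alpha)$ $k$-graph, where $n \geq n_0$ is divisible by $k-1$, then $H$ contains a Hamilton $1$-cycle.
   Context: A $k$-uniform hypergraph ($k$-graph) $H$ consists of a finite vertex set $V(H)$ and a set $E(H)$ of edges, each a $k$-element subset of $V(H)$. We identify $H$ with its edge set. For $0<\mu,p<1$, a $k$-graph $H$ on $n$ vertices is $(p,\mu)$-dense if for any (not necessarily disjoint) $X_1,\dots,X_k \subseteq V(H)$ we have $e(X_1,\dots,X_k) \geq p|X_1|\cdots|X_k| - \mu n^k$, where $e(X_1,\dots,X_k)$ is the number of $k$-tuples $(x_1,\dots,x_k) \in X_1\times\cdots\times X_k$ such that $\{x_1,\dots,x_k\} \in E(H)$. An $(n,p,\mu)$ $k$-graph is a $(p,\mu)$-dense $k$-graph with $n$ vertices. For $0<\alpha<1$, an $(n,p,\mu,\alpha)$ $k$-graph is an $(n,p,\mu)$ $k$-graph $H$ which also satisfies $\delta_1(H) \geq \alpha\binom{n}{k-1}$, where $\delta_1(H)$ is the minimum, over all vertices $v$, of the number of edges of $H$ containing $v$. A $k$-graph $C$ is an $\ell$-cycle if its vertices can be cyclically ordered in such a way that each edge of $C$ consists of $k$ consecutive vertices and each edge intersects the subsequent edge in exactly $\ell$ vertices (so an $\ell$-cycle on $n$ vertices has $n/(k-\ell)$ edges). A $k$-graph $H$ on $n$ vertices contains a Hamilton $\ell$-cycle if it contains an $n$-vertex $\ell$-cycle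 as a subgraph. *)

(* Defs.v *)
From HB Require Import structures.
From mathcomp Require Import all_boot all_order all_algebra.
From mathcomp Require Import reals.

Set Implicit Arguments.
Unset Strict Implicit.
Unset Printing Implicit Defensive.

Import Order.TTheory GRing.Theory Num.Theory.

(* The vertex set is the whole finite type V. *)
Record kgraph (k : nat) (V : finType) := KGraph {
  edges :> {set {set V}};
  edges_uniform : forall e, e \in edges -> #|e| = k
}.

Section Hypergraphs.
Variables (k : nat) (V : finType).
Implicit Types H C : kgraph k V.

Definition edge_tuples H (X : k.-tuple {set V}) : nat :=
  #|[set x : k.-tuple V |
      [forall i, tnth x i \in tnth X i] && ([set y in x] \in edges H)]|.

Definition degree H (v : V) : nat := #|[set e in edges H | v \in e]|.

(* #|edges H| bounds every degree, so as the neutral element it never affects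
   the minimum when V is nonempty. *)
Definition min_degree H : nat := \big[minn/#|edges H|]_(v : V) degree H v.

Definition dense (R : realType) (p mu : R) H : Prop :=
  forall X : k.-tuple {set V},
    (p * \prod_(i < k) (#|tnth X i|%:R) - mu * #|V|%:R ^+ k
       <= (edge_tuples H X)%:R)%R.

Definition dense_kgraph (R : realType) (n : nat) (p mu : R) H : Prop :=
  #|V| = n /\ dense p mu H.

Definition dense_mindeg_kgraph (R : realType) (n : nat) (p mu alpha : R) H
    : Prop :=
  dense_kgraph n p mu H /\ (alpha * 'C(n, k.-1)%:R <= (min_degree H)%:R)%R.

(* The k cyclically consecutive vertices v_i, v_(i+1), ..., v_(i+k-1). *)
Definition window (v : 'I_#|V| -> V) (i : 'I_#|V|) : {set V} :=
  [set v (iter j (@ordS #|V|) i) | j : 'I_k].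

(* S is the set of starting positions of the edges; enum S lists them in
   increasing order, so next (enum S) i is the cyclically subsequent one.
   The edge count rules out the degenerate configurations (no edge at all, or
   two edges sharing l vertices on one side and leaving the rest of the cyclic
   order uncovered). *)
Definition is_cycle (l : nat) C : Prop :=
  exists (v : 'I_#|V| -> V) (S : {set 'I_#|V|}),
    [/\ bijective v,
        edges C = [set window v i | i in S],
        forall i, i \in S ->
          #|window v i :&: window v (next (enum S) i)| = l
      & #|edges C| * (k - l) = #|V|].

Definition has_hamilton_cycle (l : nat) H : Prop :=
  exists C, is_cycle l C /\ edges C \subset edges H.

End Hypergraphs.

(* Main.v *)
Require Import Defs.
From HB Require Import structures.
From mathcomp Require Import all_boot all_order all_algebra.
From mathcomp Require Import reals.
From mathcomp Require Import zify.

Set Implicit Arguments.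
Unset Strict Implicit.
Unset Printing Implicit Defensive.

(** Write [k = h.+1] and let [n] be the number of vertices.  The proof is by
    absorption, with every random choice replaced by counting.

    Counting.  Suppose that the edges of a pattern pairwise meet in at most one
    vertex.  Once all vertices outside one edge are placed, the other edges
    confine the vertices of that edge to a product of sets, which is what
    density speaks about; so each edge costs a constant factor and the pattern
    has order [n ^ t] copies on [t] vertices ([pattern_count]).  Edges through a
    prescribed vertex escape density but are supplied by the minimum degree,
    and they can be imposed first if they are otherwise disjoint.

    Absorbing.  A set [S] of [h] vertices is absorbed by a loose path on a set
    [T] if there is also a loose path on the union of [S] and [T] with the same
    ends.  Such a pair is laid out on a square grid: reading the grid by columns
    gives the path through [S], and reading it by rows while passing over [S],
    which occupies part of the first row, gives the path on [T].  Vertices that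
    are close in one reading are far apart in the other, so the edges of both
    paths form a linear pattern and a positive proportion of all placements of
    the grid absorbs [S] ([absorber_count]).  A greedy choice guided by
    exponential weights ([weighted_selection]) produces disjoint absorbers,
    linearly many for each [S]; connections of three edges ([connect]) join
    them into one path that absorbs any small linear number of disjoint
    [h]-sets ([link_absorbers], [assign]).

    Covering.  Depth-first search in the rest finds a loose path that misses
    few vertices ([long_path]): a large set of dead ends and a large unexplored
    set would span an edge.  Disjoint edges at both ends of the absorbing path,
    set aside beforehand, let density join these ends to the first and last
    stretches of the long path.  As [h] divides [n], the vertices left over
    split into [h]-sets, which the absorbing path takes in
    ([hamilton_blocks]). *)

(** * Resampling coordinates of finite functions *)

Section Update.

Variables (I V : finType).
Implicit Types (f : {ffun I -> V}) (e c : seq I).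

Definition upd e f (x : seq V) : {ffun I -> V} :=
  [ffun i => nth (f i) x (index i e)].

Lemma upd_out e f (x : seq V) i : size x = size e -> i \notin e -> upd e f x i = f i.
Proof. by move=> sx ie; rewrite ffunE nth_default // (memNindex ie) sx. Qed.

Lemma map_upd e f (x : seq V) : uniq e -> size x = size e -> map (upd e f x) e = x.
Proof.
move=> ue sx; case: x sx => [|v x] sx; first by case: e ue sx.
apply: (@eq_from_nth _ v); rewrite size_map ?sx // => j je.
case: e ue sx je => [|i0 e] // ue sx je.
by rewrite (nth_map i0) // ffunE index_uniq //; apply: set_nth_default; rewrite sx.
Qed.

Lemma updK e f (x : seq V) : size x = size e -> upd e (upd e f x) (map f e) = f.
Proof.
move=> sx; apply/ffunP => i; rewrite ffunE.
have [ie|ie] := boolP (i \in e).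
  by rewrite (nth_map i) ?index_mem // nth_index.
by rewrite nth_default ?size_map ?(memNindex ie) // upd_out.
Qed.

(** Resampling the coordinates in [e] preserves the uniform distribution:
    exchanging the new values with the old ones is an involution. *)
Lemma sum_upd e m (G : {ffun I -> V} -> nat) : uniq e -> size e = m ->
  \sum_(f : {ffun I -> V}) \sum_(x : m.-tuple V) G (upd e f x)
    = #|V| ^ m * \sum_(f : {ffun I -> V}) G f.
Proof.
move=> ue se; rewrite pair_big /=.
have sz f : size (map f e) == m by rewrite size_map se.
pose sw (q : {ffun I -> V} * m.-tuple V) := (upd e q.1 q.2, Tuple (sz q.1)).
have swK : involutive sw.
  case=> f x; rewrite /sw /=; congr pair; first by rewrite updK // size_tuple.
  by apply: val_inj; rewrite /= map_upd // size_tuple.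
rewrite (reindex_inj (inv_inj swK)) /=.
under eq_bigr => q _ do rewrite updK ?size_tuple //.
rewrite -(pair_big xpredT xpredT (fun f (x : m.-tuple V) => G f)) /=.
by under eq_bigr => f _ do rewrite sum_nat_const card_tuple; rewrite big_distrr.
Qed.

Lemma card_upd e m (P : pred {ffun I -> V}) : uniq e -> size e = m ->
  \sum_(f : {ffun I -> V}) #|[set x : m.-tuple V | P (upd e f x)]|
    = #|V| ^ m * #|P|.
Proof.
move=> ue se; rewrite -[#|P|]sum1_card [in RHS]big_mkcond /=.
have := sum_upd (fun f => if f \in P then 1 else 0) ue se; rewrite /= => <-.
apply: eq_bigr => f _; rewrite -sum1_card big_mkcond.
by apply: eq_bigr => x _; rewrite inE.
Qed.

(** [A] ignores the coordinates that [Q] constrains, so restricting to [A] does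
    not change the proportion of good values. *)
Lemma root_step (A : pred {ffun I -> V}) c m (Q : pred (seq V)) C :
  uniq c -> size c = m -> 0 < #|V| ->
  (forall f x, size x = size c -> A (upd c f x) = A f) ->
  #|V| ^ m <= C * #|[set x : m.-tuple V | Q x]| ->
  #|A| <= C * #|[pred f | A f && Q (map f c)]|.
Proof.
move=> uc sc V0 Ainv hQ.
have V1 : 0 < #|V| ^ m by rewrite expn_gt0 V0.
pose B := [pred f | A f && Q (map f c)].
have E1 : \sum_(f : {ffun I -> V}) #|[set x : m.-tuple V | B (upd c f x)]|
  = #|A| * #|[set x : m.-tuple V | Q x]|.
  rewrite -[#|A|]sum1_card big_distrl /= [RHS]big_mkcond; apply: eq_bigr => f _.
  rewrite unfold_in mul1n; case: (boolP (A f)) => Af.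
    by apply: eq_card => x; rewrite !inE /= Ainv ?size_tuple // Af map_upd ?size_tuple.
  by apply: eq_card0 => x; rewrite !inE /= Ainv ?size_tuple // (negbTE Af).
have E2 := card_upd B uc sc; rewrite E1 in E2.
by rewrite -(leq_pmul2l V1) mulnCA -E2 mulnC mulnCA leq_mul2l hQ orbT.
Qed.

End Update.

(** * Counting copies of linear patterns *)

Section AlmostDisjoint.

Variable T : eqType.
Implicit Types e c : seq T.

Definition meet1 e c :=
  all (fun i => all (fun j => (i \in c) && (j \in c) ==> (i == j)) e) e.

Lemma meet1P e c :
  reflect (forall i j, i \in e -> i \in c -> j \in e -> j \in c -> i = j) (meet1 e c).
Proof.
apply: (iffP allP) => [m1 i j ie ic je jc|m1 i ie].
  by have := allP (m1 i ie) j je; rewrite ic jc => /eqP.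
by apply/allP => j je; apply/implyP => /andP[ic jc]; apply/eqP/m1.
Qed.

End AlmostDisjoint.

Section Counting.

Variables (h : nat) (V : finType) (H : kgraph h.+1 V).

Definition is_edge (s : seq V) := [set y in s] \in edges H.

(** Density with parameters [1 / K] and [1 / (M * K)], cleared of denominators
    so that the combinatorial argument takes place in [nat]. *)
Definition nat_dense M K := forall X : h.+1.-tuple {set V},
  M * \prod_(i < h.+1) #|tnth X i| <= M * K * edge_tuples H X + #|V| ^ h.+1.

Definition nat_deg K := forall v : V, 'C(#|V|, h) <= K * degree H v.

Lemma eq_is_edge s s' : s =i s' -> is_edge s = is_edge s'.
Proof.
move=> ss; rewrite /is_edge; suff -> : [set y in s] = [set y in s'] by [].
by apply/setP=> y; rewrite !inE ss.
Qed.

Lemma is_edge_uniq s : size s = h.+1 -> is_edge s -> uniq s.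
Proof.
move=> sz /edges_uniform; rewrite -sz => cs.
by apply/card_uniqP; rewrite -cs; apply: eq_card => y; rewrite inE.
Qed.

Section Patterns.

Variable I : finType.
Implicit Types (A B : pred {ffun I -> V}) (e c : seq I).

(** With the coordinates off [e] fixed, [A] restricts those in [e] to a
    product of sets, which is the only kind of constraint that the density
    hypothesis can handle. *)
Definition boxlike A e := forall f : {ffun I -> V},
  exists X : h.+1.-tuple {set V}, forall x : h.+1.-tuple V,
    A (upd e f x) = [forall i, tnth x i \in tnth X i].


Lemma boxlike_true e : boxlike xpredT e.
Proof.
move=> f; exists [tuple setT | i < h.+1] => x.
by apply/esym/forallP => i; rewrite tnth_mktuple inE.
Qed.

Lemma boxlike_and A B e : boxlike A e -> boxlike B e ->
  boxlike (fun f => A f && B f) e.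
Proof.
move=> hA hB f; have [X hX] := hA f; have [Y hY] := hB f.
exists [tuple tnth X i :&: tnth Y i | i < h.+1] => x; rewrite hX hY.
apply/andP/forallP => [[/forallP a /forallP b] i|a].
  by rewrite tnth_mktuple inE a b.
by split; apply/forallP => i; have := a i; rewrite tnth_mktuple inE => /andP[].
Qed.

(** The constraint reads at most one coordinate of [e]: its admissible values
    form one side of the box, and the other sides are full. *)
Lemma boxlike_meet1 (Q : pred (seq V)) c e : uniq e -> size e = h.+1 ->
  meet1 c e -> boxlike (fun f => Q (map f c)) e.
Proof.
move=> ue se m1 f.
have [/hasP[i ic ie]|/hasPn no] := boolP (has (mem e) c).
  have ie' : i \in e := ie.
  have jlt : index i e < h.+1 by rewrite -se index_mem.
  pose j0 := Ordinal jlt.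
  pose fy y : {ffun I -> V} := [ffun i' => if i' == i then y else f i'].
  exists [tuple if j == j0 then [set y | Q (map (fy y) c)] else setT | j < h.+1] => x.
  have -> : map (upd e f x) c = map (fy (tnth x j0)) c.
    apply/eq_in_map => a ac; rewrite [in RHS]ffunE.
    case: eqVneq => [->|ne].
      by rewrite ffunE (tnth_nth (f i)).
    rewrite upd_out ?size_tuple ?se //; apply: contraNN ne => ae.
    by apply/eqP; apply: (meet1P _ _ m1).
  apply/idP/forallP => [Qx j|/(_ j0)].
    by rewrite tnth_mktuple; case: eqP => [->|_]; rewrite inE.
  by rewrite tnth_mktuple eqxx inE.
have E x : size x = size e -> map (upd e f x) c = map f c.
  by move=> sx; apply/eq_in_map => a ac; apply: upd_out => //; apply: no.
exists [tuple if Q (map f c) then setT else set0 | j < h.+1] => x.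
rewrite E ?size_tuple ?se //; case: (Q _).
  by apply/esym/forallP => j; rewrite tnth_mktuple inE.
by apply/esym/negP => /forallP /(_ ord0); rewrite tnth_mktuple inE.
Qed.

Lemma boxlike_all (T : eqType) (l : seq T) (P : T -> pred {ffun I -> V}) e :
  (forall a, a \in l -> boxlike (P a) e) ->
  boxlike (fun f => all (P^~ f) l) e.
Proof.
elim: l => [|a l IH] hl /=; first exact: boxlike_true.
apply: boxlike_and; first by apply: hl; rewrite mem_head.
by apply: IH => d dl; apply: hl; rewrite inE dl orbT.
Qed.

(** Resampling the vertices of [e] turns the size of [A] into an average of
    sizes of boxes, to each of which density applies. *)
Lemma dense_step M K A e : 0 < #|V| -> nat_dense M K -> uniq e -> size e = h.+1 ->
  boxlike A e ->
  M * #|A| <= M * K * #|[pred f | A f && is_edge (map f e)]| + #|V| ^ #|I|.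
Proof.
move=> V0 hd ue se hA.
have V1 : 0 < #|V| ^ h.+1 by rewrite expn_gt0 V0.
pose B := [pred f | A f && is_edge (map f e)].
rewrite -(leq_pmul2l V1) mulnDr mulnCA -(card_upd A ue se).
rewrite [_ * (M * K * _)]mulnCA -(card_upd B ue se) -card_ffun.
rewrite [X in _ <= _ + X]mulnC -sum_nat_const !big_distrr -big_split /=.
apply: leq_sum => f _; have [X hX] := hA f.
have EA : #|[set x : h.+1.-tuple V | A (upd e f x)]| = \prod_(i < h.+1) #|tnth X i|.
  have -> : \prod_(i < h.+1) #|tnth X i|
      = #|(family (fun i => mem (tnth X i)) : pred {ffun 'I_h.+1 -> V})|.
    by rewrite card_family foldrE big_map big_enum.
  rewrite -(card_imset _ (can_inj (@finfun_of_tupleK V h.+1))).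
  apply: eq_card => g; apply/imsetP/familyP => [[x]|hg].
    by rewrite inE hX => /forallP hx -> i; rewrite ffunE; apply: hx.
  exists (tuple_of_finfun g); last by rewrite tuple_of_finfunK.
  by rewrite inE hX; apply/forallP => i; rewrite tnth_mktuple; apply: hg.
have EB : #|[set x : h.+1.-tuple V | B (upd e f x)]| = edge_tuples H X.
  by apply: eq_card => x; rewrite !inE /= hX map_upd ?size_tuple ?se.
by rewrite EA EB; apply: hd.
Qed.

End Patterns.
End Counting.

Section LinearPatterns.

Variables (h : nat) (V : finType) (H : kgraph h.+1 V) (M K : nat).
Hypotheses (hd : nat_dense H M K) (hg : nat_deg H K) (nh : 2 * h.+1 <= #|V|).
Local Notation n := #|V|.
Local Notation is_edge := (is_edge H).

Lemma exp_le_ffact a m : 2 * m <= a -> a ^ m <= 2 ^ m * a ^_ m.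
Proof.
move=> am; have : m <= m by []; elim: {1 3 4 5}m => [|j IH] jm; first by rewrite ffactn0.
rewrite ffactnSr !expnSr mulnACA; apply: leq_mul; [exact: IH (ltnW jm)|lia].
Qed.

Definition link_const := 2 ^ h * h`! * K.

(** The factor [2 ^ h * h`!] compares [n ^ h] with the binomial coefficient of
    the degree condition. *)
Lemma link_count v :
  n ^ h <= link_const * #|[set x : h.-tuple V | is_edge (v :: x)]|.
Proof.
have dl : degree H v <= #|[set x : h.-tuple V | is_edge (v :: x)]|.
  rewrite /degree; apply: leq_trans (leq_imset_card (fun x : h.-tuple V => [set y in v :: x]) _).
  apply/subset_leq_card/subsetP => e; rewrite inE => /andP[eH ve].
  have sz : size (enum (e :\ v)) == h.
    by rewrite -cardE; have := edges_uniform eH; rewrite (cardsD1 v) ve => /eqP.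
  have eE : e = [set y in v :: Tuple sz].
    by apply/setP=> y; rewrite !inE mem_enum !inE; case: eqVneq => // ->.
  by apply/imsetP; exists (Tuple sz) => //; rewrite inE /is_edge -eE.
have nh' : 2 * h <= n by lia.
apply: leq_trans (exp_le_ffact nh') _.
rewrite -bin_ffact /link_const -!mulnA leq_mul2l [_ * h`!]mulnC leq_mul2l.
by rewrite (leq_trans (hg v)) ?orbT // leq_mul2l dl orbT.
Qed.

Section Count.
Variable I : finType.

(** A root [(v, c)] asks for an edge made of the prescribed vertex [v] and the
    images of [c]; the edges in [es] have all their vertices free. *)
Definition fits_pattern (roots : seq (V * seq I)) (es : seq (seq I)) (f : {ffun I -> V}) :=
  all (fun e => is_edge (map f e)) es && all (fun r => is_edge (r.1 :: map f r.2)) roots.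

Lemma roots_count (roots : seq (V * seq I)) :
  (forall r, r \in roots -> uniq r.2 /\ size r.2 = h) ->
  pairwise (fun r r' => ~~ has (mem r.2) r'.2) roots ->
  n ^ #|I| <= link_const ^ size roots * #|fits_pattern roots [::]|.
Proof.
have V0 : 0 < n by lia.
elim: roots => [|[v c] roots IH] hr /=.
  by move=> _; rewrite mul1n -card_ffun; apply: subset_leq_card; apply/subsetP.
move=> /andP[dis pw]; have [|uc sc] := hr (v, c); first exact: mem_head.
apply: leq_trans (IH _ pw) _ => [r rr|]; first by apply: hr; rewrite inE rr orbT.
rewrite expnSr -mulnA leq_mul2l; apply/orP; right.
apply: leq_trans (root_step (Q := fun x => is_edge (v :: x)) uc sc V0 _ (link_count v)) _.
  move=> f x sx; rewrite /fits_pattern /=; apply: eq_in_all => r rr; congr (is_edge (_ :: _)).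
  apply/eq_in_map => a ar; apply: upd_out => //; apply/negP => ac.
  by have /allP/(_ _ rr)/hasP[] := dis; exists a.
rewrite leq_mul2l; apply/orP; right; apply: subset_leq_card; apply/subsetP => f.
by rewrite !inE /= /fits_pattern /= andbC.
Qed.

(** Rooted edges come first, since density says nothing about them; the other
    edges are then imposed one at a time.  Linearity makes the constraints
    already imposed a product on the vertices of the new edge, so density costs
    only a factor [2 * K] for each. *)
Lemma pattern_count (roots : seq (V * seq I)) (es : seq (seq I)) :
  (forall r, r \in roots -> uniq r.2 /\ size r.2 = h) ->
  pairwise (fun r r' => ~~ has (mem r.2) r'.2) roots ->
  (forall e, e \in es -> uniq e /\ size e = h.+1) ->
  pairwise (@meet1 I) es ->
  (forall r e, r \in roots -> e \in es -> meet1 r.2 e) ->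
  0 < K ->
  2 * (link_const ^ size roots * (2 * K) ^ size es) <= M ->
  n ^ #|I| <= link_const ^ size roots * (2 * K) ^ size es * #|fits_pattern roots es|.
Proof.
move=> hr dis; have V0 : 0 < n by lia.
elim: es => [|e es IH] he /= pw hre K0 hM; first by rewrite muln1; apply: roots_count.
move: pw => /andP[me pw]; have [|ue se] := he e; first exact: mem_head.
set C := link_const ^ size roots * (2 * K) ^ size es.
have EC : link_const ^ size roots * (2 * K) ^ (size es).+1 = 2 * K * C by rewrite expnS /C; lia.
rewrite EC in hM *.
(* This keeps the error term of density below half of the main term. *)
have hC : 2 * C <= M by apply: leq_trans hM; nia.
have {IH} IH : n ^ #|I| <= C * #|fits_pattern roots es|.
  apply: IH => // [e' e'e|r e' rr e'e]; first by apply: he; rewrite inE e'e orbT.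
  by apply: hre => //; rewrite inE e'e orbT.
have box : boxlike h (fits_pattern roots es) e.
  apply: boxlike_and; apply: boxlike_all => a ain.
    apply: (boxlike_meet1 is_edge) => //.
    have /meet1P m := allP me a ain.
    by apply/meet1P => i j ia ie ja je; apply: m.
  apply: (boxlike_meet1 (fun x => is_edge (a.1 :: x))) => //.
  by apply: hre => //; rewrite mem_head.
have := dense_step V0 hd ue se box.
have -> : #|[pred f | fits_pattern roots es f && is_edge (map f e)]| = #|fits_pattern roots (e :: es)|.
  by apply: eq_card => f; rewrite !inE /= /fits_pattern /= [LHS]andbC andbA.
move: #|fits_pattern roots es| #|fits_pattern roots (e :: es)| (n ^ #|I|) IH => a b N IH st.
have C0 : 0 < C by rewrite muln_gt0 !expn_gt0 !muln_gt0 expn_gt0 fact_gt0 K0.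
have M0 : 0 < M by nia.
rewrite -(leq_pmul2l M0).
have h1 : C * (M * a) <= C * (M * K * b + N) by rewrite leq_mul2l st orbT.
have h2 : M * N <= M * (C * a) by rewrite leq_mul2l IH orbT.
have h3 : 2 * C * N <= M * N by rewrite leq_mul2r hC orbT.

lia.
Qed.

End Count.
End LinearPatterns.

(** * Loose paths *)

Section LoosePaths.

Variables (h : nat) (V : finType) (H : kgraph h.+1 V).
Local Notation is_edge := (is_edge H).

(** A loose path is a start vertex followed by blocks of [h] vertices, each of
    which forms an edge with the last vertex before it.  Replacing a stretch of
    a path by another one with the same ends is then a list operation. *)
Fixpoint loose_path (x : V) (bs : seq (seq V)) : bool :=
  if bs is b :: bs' then is_edge (x :: b) && loose_path (last x b) bs' else true.

Definition path_end (x : V) (bs : seq (seq V)) := last x (flatten bs).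

Definition sized (bs : seq (seq V)) := all (fun b => size b == h) bs.

Lemma path_end_cat x bs1 bs2 : path_end x (bs1 ++ bs2) = path_end (path_end x bs1) bs2.
Proof. by rewrite /path_end flatten_cat last_cat. Qed.

Lemma loose_path_cat x bs1 bs2 :
  loose_path x (bs1 ++ bs2) = loose_path x bs1 && loose_path (path_end x bs1) bs2.
Proof.
elim: bs1 x => //= b bs1 IH x; rewrite IH andbA; congr (_ && loose_path _ _).
by rewrite /path_end /= last_cat.
Qed.

Lemma sized_cat bs1 bs2 : sized (bs1 ++ bs2) = sized bs1 && sized bs2.
Proof. exact: all_cat. Qed.

Lemma size_sized bs : sized bs -> size (flatten bs) = size bs * h.
Proof. by elim: bs => //= b bs IH /andP[/eqP sb /IH]; rewrite size_cat sb => ->. Qed.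

(** For a path starting at [w 0]: the next [m * h] values of [w], cut into
    blocks. *)
Definition blocks (w : nat -> V) m :=
  [seq map w (iota (j * h).+1 h) | j <- iota 0 m].

Lemma blocksS w m : blocks w m.+1 = blocks w m ++ [:: map w (iota (m * h).+1 h)].
Proof. by rewrite /blocks -addn1 iotaD map_cat. Qed.

Lemma flatten_blocks w m : flatten (blocks w m) = map w (iota 1 (m * h)).
Proof.
elim: m => // m IH; rewrite blocksS flatten_cat IH /= cats0 -map_cat.
by rewrite -iotaD mulSnr.
Qed.

Lemma path_end_blocks w m : path_end (w 0) (blocks w m) = w (m * h).
Proof.
rewrite /path_end flatten_blocks last_map; congr w.
by case: (m * h) => // a; rewrite -[X in iota _ X]addn1 iotaD last_cat.
Qed.

Lemma sized_blocks w m : sized (blocks w m).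
Proof. by apply/allP => b /mapP[j _ ->]; rewrite size_map size_iota. Qed.

Lemma loose_path_blocks w m :
  (forall j, j < m -> is_edge (map w (iota (j * h) h.+1))) -> loose_path (w 0) (blocks w m).
Proof.
elim: m => // m IH hw; rewrite blocksS loose_path_cat IH => [|j jm]; last by apply: hw; lia.
by rewrite path_end_blocks /= andbT; apply: hw.
Qed.

End LoosePaths.

Lemma all_neq_pairwise (T : eqType) (r : rel T) s : uniq s ->
  {in s &, forall x y, x != y -> r x y} -> pairwise r s.
Proof.
elim: s => //= x s IH /andP[xs us] hr; apply/andP; split.
  apply/allP => y ys; apply: hr; rewrite ?mem_head // ?inE ?ys ?orbT //.
  by apply: contraNneq xs => ->.
by apply: IH => // a b as_ bs; apply: hr; rewrite inE ?as_ ?bs orbT.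
Qed.

(** * Absorbers: two readings of a square grid *)

Section Grid.

Variable h : nat.

(** The places of an absorber are numbered row by row.  With a side of
    [3 * h + 1], the number of places is 1 modulo [h]; distinct places
    within [2 * h] are at least [3 * h] apart in the column order; and places 1 to
    [h], reserved for the absorbed set, are pairwise more than [2 * h] apart in
    the column order. *)
Definition side := (3 * h).+1.
Definition last_pos := h * (9 * h + 6).
Definition transp i := (i %% side) * side + i %/ side.
(** The place visited at step [i] by the path that passes over the reserved
    places. *)
Definition skip i := if i == 0 then 0 else i + h.
Definition in_slots i := (0 < i <= h).

Lemma last_posE : last_pos.+1 = side * side.
Proof. rewrite /last_pos /side; lia. Qed.

Lemma transp_lt i : i <= last_pos -> transp i <= last_pos.
Proof.
rewrite -ltnS last_posE => il; rewrite -ltnS last_posE /transp.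
have a := ltn_pmod i (isT : 0 < side).
have b : i %/ side < side by rewrite ltn_divLR.
have c : (i %% side).+1 * side <= side * side by rewrite leq_mul2r a orbT.
lia.
Qed.

Lemma transpK i : i <= last_pos -> transp (transp i) = i.
Proof.
rewrite -ltnS last_posE => il; rewrite {1}/transp.
have b : i %/ side < side by rewrite ltn_divLR.
by rewrite /transp modnMDl (modn_small b) divnMDl // (divn_small b) addn0 -divn_eq.
Qed.

(** Such places lie in different columns, of the same row or of two consecutive
    rows, and then transposition puts them at least [side - 1] apart. *)
Lemma transp_far a b : a < b <= a + 2 * h -> transp a + 3 * h <= transp b \/ transp b + 3 * h <= transp a.
Proof.
move=> ab; rewrite /transp.
have ea := divn_eq a side; have eb := divn_eq b side.
have la := ltn_pmod a (isT : 0 < side); have lb := ltn_pmod b (isT : 0 < side).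
move: (a %/ side) (a %% side) (b %/ side) (b %% side) ea eb la lb => qa ra qb rb.
move=> ea eb la lb; subst a b; rewrite /side in ab la lb *.
have [E|E] : qb = qa \/ qb = qa.+1.
  have h1 : qa <= qb by nia.
  have h2 : qb < qa.+2 by nia.
  lia.
- subst qb; left; nia.
- subst qb; right; nia.
Qed.

Lemma transp_last : transp last_pos = last_pos.
Proof.
have E : last_pos = (3 * h) * side + 3 * h by rewrite /last_pos /side; lia.
by rewrite /transp {1 2}E modnMDl divnMDl // divn_small ?modn_small // addn0 -E.
Qed.

Lemma transp_slot x : in_slots x -> transp x = x * side.
Proof.
move=> /andP[_ xh]; have xs : x < side by rewrite /side; lia.
by rewrite /transp modn_small // divn_small // addn0.
Qed.

Definition edge_places j := iota (j * h) h.+1.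

Lemma mem_edge_places i j : (i \in edge_places j) = (j * h <= i <= j * h + h).
Proof. by rewrite mem_iota; lia. Qed.

Lemma win_meet j j' i i' : j != j' -> i \in edge_places j -> i \in edge_places j' ->
  i' \in edge_places j -> i' \in edge_places j' -> i = i'.
Proof.
rewrite !mem_edge_places => jj.
wlog : j j' jj / j < j' => [W|jl] a b c d.
  have [l|l] : j < j' \/ j' < j by lia.
    exact: (W j j').
  by apply: (W j' j); rewrite // eq_sym.
have : j * h + h <= j' * h by nia.
lia.
Qed.

End Grid.

Section GridWindows.

Variable h : nat.
Local Notation last_pos := (last_pos h).
Local Notation transp := (transp h).
Local Notation skip := (skip h).
Local Notation in_slots := (in_slots h).

Definition base_len := 9 * h + 5.
Definition base_win j := map skip (edge_places h j).
Definition alt_win j := map transp (edge_places h j).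

Lemma last_pos_base : last_pos = base_len * h + h.
Proof. rewrite /last_pos /base_len; lia. Qed.

Lemma skip_inj : injective skip.
Proof. move=> i j; rewrite /skip; case: eqP; case: eqP; lia. Qed.

Lemma win_le i j : j <= base_len -> i \in edge_places h j -> i <= last_pos.
Proof. rewrite mem_edge_places last_pos_base; nia. Qed.

Lemma win_le1 i j : j < base_len -> i \in edge_places h j -> skip i <= last_pos.
Proof. rewrite mem_edge_places last_pos_base /skip; case: eqP; nia. Qed.

Lemma base_win_le i j : j < base_len -> i \in base_win j -> i <= last_pos.
Proof. by move=> jm /mapP[x xj ->]; apply: win_le1 xj. Qed.

Lemma alt_win_le i j : j <= base_len -> i \in alt_win j -> i <= last_pos.
Proof. by move=> jm /mapP[x xj ->]; apply/transp_lt/(win_le jm). Qed.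

Lemma transp_inj : {in [pred i | i <= last_pos] &, injective transp}.
Proof. by move=> i j /= il jl e; rewrite -(@transpK h i) // e transpK. Qed.

Lemma uniq_base_win j : uniq (base_win j).
Proof. by rewrite map_inj_uniq ?iota_uniq //; apply: skip_inj. Qed.

Lemma uniq_alt_win j : j <= base_len -> uniq (alt_win j).
Proof.
move=> jm; rewrite map_inj_in_uniq ?iota_uniq // => a b aj bj.
by apply: transp_inj; rewrite inE; apply: win_le jm _.
Qed.

Lemma meet1_base_base j j' : j != j' -> meet1 (base_win j) (base_win j').
Proof.
move=> jj; apply/meet1P => a b /mapP[i ij ->] + /mapP[i' ij' ->].
rewrite !(mem_map skip_inj) => iw iw'.
by rewrite (win_meet jj ij iw ij' iw').
Qed.

Lemma mem_alt_win i j : j <= base_len -> i <= last_pos -> (transp i \in alt_win j) = (i \in edge_places h j).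
Proof.
move=> jm il; apply/mapP/idP => [[x xw /transp_inj ->]|]; rewrite ?inE //; first exact: win_le xw.
by exists i.
Qed.

Lemma meet1_alt_alt j j' : j <= base_len -> j' <= base_len -> j != j' -> meet1 (alt_win j) (alt_win j').
Proof.
move=> jm jm' jj; apply/meet1P => a b /mapP[i ij ->] + /mapP[i' ij' ->].
rewrite !mem_alt_win ?(win_le jm) // => iw iw'.
by rewrite (win_meet jj ij iw ij' iw').
Qed.

(** An edge of the row reading spans at most [2 * h] places, including the
    reserved ones that it may pass over, so [transp_far] spreads its vertices
    farther than an edge of the column reading extends. *)
Lemma meet1_base_alt j j' : j < base_len -> j' <= base_len -> meet1 (base_win j) (alt_win j').
Proof.
move=> jm jm'; apply/meet1P => a b aw /mapP[i iw ea] bw /mapP[i' iw' eb].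
have ia : transp a = i by rewrite ea transpK // (win_le jm').
have ib : transp b = i' by rewrite eb transpK // (win_le jm').
case/mapP: aw => x xw exa; case/mapP: bw => y yw eyb.
move: iw iw' xw yw; rewrite !mem_edge_places -ia -ib => iw iw' xw yw.
wlog : a b x y exa eyb iw iw' xw yw {ea eb ia ib i i'} / a < b => [W|ab].
  have [ab|ab|//] := ltngtP a b; first exact: (W a b x y).
  by apply/esym; apply: (W b a y x).
have ba : b <= a + 2 * h by rewrite exa eyb /skip; do 2 case: eqP => ?; lia.
have := @transp_far h a b; rewrite ab ba => /(_ isT) far.
lia.
Qed.

Lemma slots_far x y i : in_slots x -> in_slots y -> transp x <= i + h -> i <= transp x + h ->
  transp y <= i + h -> i <= transp y + h -> x = y.
Proof.
move=> xS yS; rewrite !transp_slot // /side => a b c d.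
have [l|l|//] := ltngtP x y; nia.
Qed.

Lemma slot_in_win x j : j <= base_len -> in_slots x -> x \in alt_win j -> transp x \in edge_places h j.
Proof.
move=> jm xS /mapP[i iw e]; by rewrite e transpK // (win_le jm).
Qed.

Lemma slot_unique x y j : j <= base_len -> in_slots x -> in_slots y -> x \in alt_win j -> y \in alt_win j -> x = y.
Proof.
move=> jm xS yS /(slot_in_win jm xS) + /(slot_in_win jm yS).
rewrite !mem_edge_places => a b; apply: (@slots_far x y (transp x)); lia.
Qed.

Definition has_slot j := has in_slots (alt_win j).
(** An edge of the column reading contains at most one reserved place; the
    default value is not reached when [has_slot j] holds. *)
Definition slot_of j := head 0 (filter in_slots (alt_win j)).
Definition rest j := filter (predC in_slots) (alt_win j).

Lemma perm_alt_win j : j <= base_len -> has_slot j -> perm_eq (alt_win j) (slot_of j :: rest j) && in_slots (slot_of j).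
Proof.
move=> jm; rewrite /has_slot has_filter /slot_of /rest => hS.
have : all in_slots (filter in_slots (alt_win j)) by apply: filter_all.
have : {subset filter in_slots (alt_win j) <= alt_win j} by move=> x; rewrite mem_filter => /andP[].
have : uniq (filter in_slots (alt_win j)) by rewrite filter_uniq ?uniq_alt_win.
have := perm_filterC in_slots (alt_win j).
case: (filter in_slots (alt_win j)) hS => [|x [|y s]] // _.
  move=> p _ _ /andP[xS _]; apply/andP; split=> //.
  by rewrite perm_sym; apply/permPl.
move=> _ /= /andP[xy _] sub /andP[xS /andP[yS _]].
move: xy; rewrite (@slot_unique x y j) ?mem_head ?sub ?inE ?eqxx ?orbT //.
Qed.

Lemma size_rest j : j <= base_len -> has_slot j -> size (rest j) = h.
Proof.
move=> jm hj; have /andP[/perm_size] := perm_alt_win jm hj.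
by rewrite size_map size_iota => -[].
Qed.

(** Reserved places are too far apart in the column order for edges through two
    of them to meet, and two edges through the same one meet only there. *)
Lemma rest_disjoint j j' : j <= base_len -> j' <= base_len -> has_slot j -> has_slot j' ->
  j != j' -> ~~ has (mem (rest j)) (rest j').
Proof.
move=> jm jm' /hasP[x xw xS] /hasP[y yw yS] jj.
apply/hasPn => u; rewrite inE !mem_filter => /andP[/= uS uw']; rewrite uS /=.
apply/negP => uw.
have trx := slot_in_win jm xS xw; have try_ := slot_in_win jm' yS yw.
have ul : u <= last_pos by apply: alt_win_le uw.
have ut : transp u \in edge_places h j by rewrite -mem_alt_win // ?transp_lt // transpK.
have ut' : transp u \in edge_places h j' by rewrite -mem_alt_win // ?transp_lt // transpK.
have xy : x = y.
  by apply: (@slots_far x y (transp u)) => //; move: trx try_ ut ut'; rewrite !mem_edge_places; lia.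
subst y.
have := win_meet jj ut ut' trx try_ => e.
have xl : x <= last_pos by apply: alt_win_le xw.
have ux : u = x by apply: transp_inj.
by rewrite ux /= xS in uS.
Qed.

End GridWindows.

Section Absorber.

Variables (h : nat) (V : finType) (H : kgraph h.+1 V) (v0 : V).
Hypothesis h0 : 0 < h.
Local Notation is_edge := (is_edge H).
Local Notation last_pos := (last_pos h).
Local Notation base_len := (base_len h).
Local Notation n := #|V|.
Notation placement := {ffun 'I_last_pos.+1 -> V}.
Implicit Types (f : placement) (S : seq V).

Definition val_at f i : V := f (inord i).
Definition swap f S i : V := if in_slots h i then nth v0 S i.-1 else val_at f i.
Definition base f := blocks h (fun i => val_at f (skip h i)) base_len.
Definition alt f S := blocks h (fun i => swap f S (transp h i)) base_len.+1.
Definition fstart f : V := val_at f 0.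
Definition fend f : V := val_at f last_pos.

Definition roots S : seq (V * seq 'I_last_pos.+1) :=
  [seq (nth v0 S (slot_of h j).-1, map inord (rest h j))
     | j <- filter (has_slot h) (iota 0 base_len.+1)].
Definition free_edges : seq (seq 'I_last_pos.+1) :=
  [seq map inord (base_win h j) | j <- iota 0 base_len] ++
  [seq map inord (alt_win h j) | j <- filter (predC (has_slot h)) (iota 0 base_len.+1)].
(** The edges of both readings at once, those through a vertex of [S] being
    rooted at it. *)
Definition fits f S := fits_pattern H (roots S) free_edges f.

Lemma loose_path_base f S : fits f S -> loose_path H (fstart f) (base f).
Proof.
move=> /andP[+ _]; rewrite all_cat => /andP[/allP hw _].
apply: (@loose_path_blocks h V H (fun i => val_at f (skip h i))) => j jm.
have jin : j \in iota 0 base_len by rewrite mem_iota.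
by have := hw _ (map_f (fun j => map inord (base_win h j)) jin); rewrite /base_win -!map_comp.
Qed.

Lemma loose_path_alt f S : fits f S -> loose_path H (fstart f) (alt f S).
Proof.
move=> /andP[+ /allP hr]; rewrite all_cat => /andP[_ /allP hw].
have -> : fstart f = swap f S (transp h 0) by rewrite /transp mod0n div0n.
apply: (@loose_path_blocks h V H (fun i => swap f S (transp h i))) => j jm.
have -> : [seq swap f S (transp h i) | i <- iota (j * h) h.+1] = map (swap f S) (alt_win h j).
  by rewrite /alt_win -map_comp.
have [hS|nS] := boolP (has_slot h j).
  have jin : j \in filter (has_slot h) (iota 0 base_len.+1) by rewrite mem_filter hS mem_iota.
  have := hr _ (map_f (fun j => (nth v0 S (slot_of h j).-1, map inord (rest h j))) jin).
  rewrite /= -map_comp => e1.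
  have /andP[pw sS] := perm_alt_win (jm : j <= base_len) hS.
  rewrite (eq_is_edge H (perm_mem (perm_map (swap f S) pw))) /= {1}/swap sS.
  rewrite (_ : map (swap f S) _ = map (f \o inord) (rest h j)) //.
  by apply/eq_in_map => x; rewrite mem_filter /swap => /andP[/= /negbTE ->].
have jin : j \in filter (predC (has_slot h)) (iota 0 base_len.+1).
  by rewrite mem_filter mem_iota /= nS.
have := hw _ (map_f (fun j => map inord (alt_win h j)) jin); rewrite -map_comp.
rewrite (_ : map (swap f S) _ = map (f \o inord) (alt_win h j)).
  by [].
by apply/eq_in_map => x xw; rewrite /swap (negbTE (hasPn nS x xw)).
Qed.

Lemma path_end_base f : path_end (fstart f) (base f) = fend f.
Proof.
have e : fstart f = val_at f (skip h 0) by [].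
rewrite e (@path_end_blocks h V (fun i => val_at f (skip h i))) /skip.
case: eqP => [|_]; first by rewrite /base_len; nia.
by rewrite /fend last_pos_base.
Qed.

Lemma path_end_alt f S : path_end (fstart f) (alt f S) = fend f.
Proof.
have -> : fstart f = swap f S (transp h 0) by rewrite /transp mod0n div0n.
rewrite (@path_end_blocks h V (fun i => swap f S (transp h i))).
have -> : base_len.+1 * h = last_pos by rewrite last_pos_base; lia.
rewrite transp_last /swap ifF //; apply/negbTE; rewrite /in_slots last_pos_base /base_len; nia.
Qed.

Lemma flatten_base f : flatten (base f) = map (val_at f) (iota h.+1 (base_len * h)).
Proof.
rewrite flatten_blocks -(addn1 h) iotaDl -map_comp; apply/eq_in_map => i.
by rewrite mem_iota /skip /= => /andP[i0 _]; rewrite gtn_eqF // addnC.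
Qed.

(** Transposition permutes the places of the grid, and the row reading leaves
    out exactly the reserved ones. *)
Lemma perm_alt f S : size S = h -> perm_eq (flatten (alt f S)) (S ++ flatten (base f)).
Proof.
move=> sS; rewrite flatten_base flatten_blocks.
have -> : base_len.+1 * h = last_pos by rewrite last_pos_base; lia.
have pt : perm_eq (map (transp h) (iota 1 last_pos)) (iota 1 last_pos).
  apply: uniq_perm; [|exact: iota_uniq|].
    rewrite map_inj_in_uniq ?iota_uniq // => i j; rewrite !mem_iota => il jl.
    by apply: transp_inj; rewrite inE; lia.
  have t0 : transp h 0 = 0 by rewrite /transp mod0n div0n.
  have tp i : i <= last_pos -> (0 < transp h i) = (0 < i).
    move=> il; rewrite !lt0n; congr negb; apply/eqP/eqP => [e|->//].
    by rewrite -(transpK il) e.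
  move=> i; rewrite mem_iota; apply/mapP/idP => [[j]|il].
    rewrite mem_iota => jl -> ; have jl' : j <= last_pos by lia.
    by have := transp_lt jl'; rewrite tp //; lia.
  have il' : i <= last_pos by lia.
  exists (transp h i); last by rewrite transpK.
  by rewrite mem_iota tp //; have := transp_lt il'; lia.
rewrite (map_comp (swap f S) (transp h)); apply: perm_trans (perm_map (swap f S) pt) _.
have -> : last_pos = h + base_len * h by rewrite last_pos_base; lia.
rewrite iotaD map_cat add1n.
have -> : map (swap f S) (iota 1 h) = S.
  apply: (@eq_from_nth _ v0); rewrite size_map size_iota ?sS // => i ih.
  by rewrite (nth_map 0) ?size_iota // nth_iota // /swap /in_slots ifT //; lia.
have -> // : map (swap f S) (iota h.+1 (base_len * h)) = map (val_at f) (iota h.+1 (base_len * h)).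
apply/eq_in_map => i; rewrite mem_iota /swap => ih; rewrite ifF //.
by rewrite /in_slots; lia.
Qed.

Lemma uniq_map_inord (s : seq nat) : (forall i, i \in s -> i <= last_pos) ->
  uniq s -> uniq (map (@inord last_pos) s).
Proof.
move=> hs us; rewrite map_inj_in_uniq // => i j /hs il /hs jl e.
by rewrite -(@inordK last_pos i) // e inordK.
Qed.

Lemma mem_map_inord (s : seq nat) i : (forall i, i \in s -> i <= last_pos) ->
  i <= last_pos -> ((@inord last_pos i) \in map inord s) = (i \in s).
Proof.
move=> hs il; apply/mapP/idP => [[j js e]|]; last by exists i.
by rewrite -(@inordK last_pos i) // e inordK // ltnS hs.
Qed.

Lemma meet1_inord (e c : seq nat) : (forall i, i \in e -> i <= last_pos) ->
  (forall i, i \in c -> i <= last_pos) ->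
  meet1 e c -> meet1 (map (@inord last_pos) e) (map inord c).
Proof.
move=> he hc /meet1P m; apply/meet1P => a b /mapP[i ie ->] + /mapP[j je ->].
rewrite !mem_map_inord // ?he // => ic jc.
by rewrite (m _ _ ie ic je jc).
Qed.

Variables (M K : nat).
Hypotheses (hd : nat_dense H M K) (hg : nat_deg H K) (nh : 2 * h.+1 <= n) (K0 : 0 < K).

Definition absorb_const :=
  (link_const h K) ^ base_len.+1 * (2 * K) ^ (base_len + base_len.+1).

(** Both readings together form a linear pattern in which the rooted edges have
    disjoint free parts. *)
Lemma absorber_count S : 2 * absorb_const <= M ->
  n ^ last_pos.+1 <= absorb_const * #|[pred f | fits f S]|.
Proof.
move=> hM.
have l0 : 0 < link_const h K by rewrite !muln_gt0 expn_gt0 fact_gt0.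
have le : link_const h K ^ size (roots S) * (2 * K) ^ size free_edges <= absorb_const.
  have k2 : 0 < 2 * K by lia.
  apply: leq_mul; rewrite leq_pexp2l //.
    by rewrite /roots size_map size_filter (leq_trans (count_size _ _)) ?size_iota.
  rewrite /free_edges size_cat !size_map size_iota leq_add2l size_filter.
  by rewrite (leq_trans (count_size _ _)) ?size_iota.
apply: leq_trans (leq_mul le (leqnn _)); rewrite -[in leqLHS](card_ord last_pos.+1).
have w1b j : j \in iota 0 base_len -> forall i, i \in base_win h j -> i <= last_pos.
  by rewrite mem_iota => jm i; apply: base_win_le.
have w2b (P : pred nat) j : j \in filter P (iota 0 base_len.+1) ->
    [/\ P j, j <= base_len & forall i, i \in alt_win h j -> i <= last_pos].
  by rewrite mem_filter mem_iota => /andP[Pj jm]; split=> // i; apply: alt_win_le.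
have rw2 j i : i \in rest h j -> i \in alt_win h j by rewrite mem_filter => /andP[].
apply: (pattern_count hd hg nh).
- move=> r /mapP[j /w2b[hS jm jb] ->] /=; split; last by rewrite size_map size_rest.
  apply: uniq_map_inord; last by rewrite filter_uniq ?uniq_alt_win.
  by move=> i /rw2; apply: jb.
- rewrite pairwise_map; apply: all_neq_pairwise; first by rewrite filter_uniq ?iota_uniq.
  move=> j j' /w2b[hS jm jb] /w2b[hS' jm' jb'] jj /=.
  apply: contraNN (rest_disjoint jm jm' hS hS' jj) => /hasP[_ /mapP[i ir ->]].
  rewrite inE /= mem_map_inord => [ir'||]; first by apply/hasP; exists i.
    by move=> a /rw2; apply: jb.
  by apply: jb'; apply: rw2.
- move=> e; rewrite mem_cat => /orP[/mapP[j jm ->]|/mapP[j /w2b[_ jm jb] ->]].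
    split; last by rewrite !size_map size_iota.
    by apply: uniq_map_inord; [apply: w1b | apply: uniq_base_win].
  split; last by rewrite !size_map size_iota.
  by apply: uniq_map_inord => //; apply: uniq_alt_win.
- rewrite pairwise_cat; apply/and3P; split.
  + apply/allrelP => _ _ /mapP[j jm ->] /mapP[j' /w2b[_ jm' jb'] ->].
    apply: meet1_inord => //; first exact: w1b.
    by apply: meet1_base_alt => //; move: jm; rewrite mem_iota.
  + rewrite pairwise_map; apply: all_neq_pairwise; first exact: iota_uniq.
    move=> j j' jm jm' jj; apply: (@meet1_inord (base_win h j) (base_win h j')); [exact: w1b.. |].
    exact: meet1_base_base.
  + rewrite pairwise_map; apply: all_neq_pairwise; first by rewrite filter_uniq ?iota_uniq.
    move=> j j' /w2b[_ jm jb] /w2b[_ jm' jb'] jj; apply: (@meet1_inord (alt_win h j) (alt_win h j')) => //.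
    exact: meet1_alt_alt.
- move=> r e /mapP[j /w2b[hS jm jb] ->] /=.
  have rb i : i \in rest h j -> i <= last_pos by move=> /rw2 /jb.
  have sub c : meet1 (alt_win h j) c -> meet1 (rest h j) c.
    by move=> /meet1P m; apply/meet1P => a b /rw2 aw ac /rw2 bw bc; apply: m.
  rewrite mem_cat => /orP[/mapP[j' jm' ->]|/mapP[j' /w2b[/= nS jm' jb'] ->]].
    apply: (@meet1_inord (rest h j) (base_win h j')) => //; first exact: w1b.
    apply: sub; rewrite mem_iota in jm'.
    have /meet1P m := @meet1_base_alt h j' j jm' jm.
    by apply/meet1P => a b aw ac bw bc; apply: m.
  apply: (@meet1_inord (rest h j) (alt_win h j')) => //; apply: sub; apply: meet1_alt_alt => //.
  by apply: contraNneq nS => <-.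
- exact: K0.
- by apply: leq_trans hM; rewrite leq_mul2l.
Qed.

End Absorber.

(** * A linear number of disjoint absorbers *)

Section Avoiding.

Variables (I V : finType).
Local Notation n := #|V|.

Lemma card_sample c m (Q : pred (seq V)) : uniq c -> size c = m ->
  n ^ m * #|[pred f : {ffun I -> V} | Q (map f c)]| = n ^ #|I| * #|[set x : m.-tuple V | Q x]|.
Proof.
move=> uc sc; rewrite -(card_upd _ uc sc) -card_ffun -sum_nat_const.
apply: eq_bigr => f _; apply: eq_card => x.
by rewrite !inE /= map_upd // size_tuple.
Qed.

Lemma count_hitting (U : {set V}) :
  n * #|[pred f : {ffun I -> V} | [exists i, f i \in U]]| <= n ^ #|I| * (#|I| * #|U|).
Proof.
have one i : n * #|[pred f : {ffun I -> V} | f i \in U]| <= n ^ #|I| * #|U|.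
  have := @card_sample [:: i] 1 (fun x => all (mem U) x) isT erefl.
  rewrite expn1 (eq_card (B := [pred f : {ffun I -> V} | f i \in U])) => [->|f]; last first.
    by rewrite !inE /= andbT.
  rewrite leq_mul2l; apply/orP; right.
  apply: leq_trans (leq_imset_card (fun y => [tuple y]) U).
  apply/subset_leq_card/subsetP => -[[|a [|? ?]] //= sx]; rewrite inE /= andbT => aU.
  by apply/imsetP; exists a => //; apply: val_inj.
apply: leq_trans (_ : n * \sum_i #|[pred f : {ffun I -> V} | f i \in U]| <= _).
  rewrite leq_mul2l; apply/orP; right.
  rewrite -sum1_card; under [leqRHS]eq_bigr do rewrite -sum1_card big_mkcond.
  rewrite exchange_big big_mkcond; apply: leq_sum => f _; rewrite !inE /=.
  case: ifP => // /existsP[i fi]; rewrite (bigD1 i) //= inE /= fi; lia.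
rewrite big_distrr /=; apply: leq_trans (leq_sum _ (fun i _ => one i)) _.
by rewrite sum_nat_const mulnCA.
Qed.

Lemma count_noninjective :
  n * #|[pred f : {ffun I -> V} | ~~ injectiveb f]| <= n ^ #|I| * (#|I| * #|I|).
Proof.
have one i j : i != j -> n * #|[pred f : {ffun I -> V} | f i == f j]| <= n ^ #|I|.
  move=> ij; have [/eqP n0|n0] := posnP n; first by rewrite (eqP n0) mul0n.
  have uij : uniq [:: i; j] by rewrite /= inE ij.
  have := @card_sample [:: i; j] 2 (fun x => if x is [:: a; b] then a == b else false) uij erefl.
  rewrite (eq_card (B := [pred f : {ffun I -> V} | f i == f j])) // => e.
  rewrite -(leq_pmul2l n0) mulnA mulnn e mulnC leq_mul2r; apply/orP; right.
  rewrite -[leqRHS]cardsT.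
  apply: leq_trans (leq_imset_card (fun y => [tuple y; y]) _).
  apply/subset_leq_card/subsetP => -[[|a [|b [|? ?]]] //= sx]; rewrite inE => /eqP ab.
  by apply/imsetP; exists a; rewrite ?inE //; apply: val_inj; rewrite /= ab.
apply: leq_trans (_ : n * \sum_(p : I * I | p.1 != p.2) #|[pred f : {ffun I -> V} | f p.1 == f p.2]| <= _).
  rewrite leq_mul2l; apply/orP; right.
  rewrite -sum1_card; under [leqRHS]eq_bigr do rewrite -sum1_card big_mkcond.
  rewrite exchange_big big_mkcond; apply: leq_sum => f _; rewrite !inE /=.
  case: ifP => // /injectivePn[i [j ij fij]].
  by rewrite (bigD1 (i, j)) //= inE /= fij eqxx.
rewrite big_distrr /=; apply: leq_trans (leq_sum _ (fun p hp => one p.1 p.2 hp)) _.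
rewrite sum_nat_const mulnC leq_mul2l; apply/orP; right.
by apply: leq_trans (max_card _) _; rewrite card_prod.
Qed.

End Avoiding.

Section Selection.

Variables (X Y : finType) (ab : Y -> X -> bool) (ok : seq Y -> Y -> bool).

Fixpoint chain (ys : seq Y) := if ys is y :: ys' then ok ys' y && chain ys' else true.

(** Greedy derandomisation.  An element [x] has weight 2 to the number of
    selected [y] that miss it.  Averaging gives an admissible [y] that hits at
    least [1 / C] of the total weight, so each round multiplies the total
    weight by at most [2 - 1 / C]; the conclusion compares the weight of [x]
    alone with the total. *)
Lemma weighted_selection C m (x0 : X) : 0 < #|Y| ->
  (forall ys, size ys < m -> chain ys ->
     forall x, #|Y| <= C * #|[pred y | ok ys y && ab y x]|) ->
  exists ys, [/\ size ys = m, chain ys &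
    forall x, (2 * C) ^ m <= 2 ^ count (ab^~ x) ys * (2 * C).-1 ^ m * #|X|].
Proof.
move=> Y0 hY.
pose W ys x := 2 ^ count (predC (ab^~ x)) ys.
have [ys [sy cy hW]] : exists ys, [/\ size ys = m, chain ys &
    C ^ m * \sum_x W ys x <= (2 * C).-1 ^ m * #|X|].
  have : m <= m by []; elim: {1 3 4 5}m => [|j IH] jm.
    by exists [::]; split=> //; rewrite /W /= sum_nat_const muln1 mul1n.
  have [ys [sy cy hW]] := IH (ltnW jm); rewrite -sy in jm.
  have {}hY := hY ys jm cy.
  pose gain y := \sum_(x | ok ys y && ab y x) W ys x.
  have tot : #|Y| * \sum_x W ys x <= \sum_y C * gain y.
    rewrite -big_distrr /= /gain (exchange_big_dep xpredT) //= !big_distrr /=.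
    by apply: leq_sum => x _; rewrite sum_nat_const mulnA leq_mul2r hY orbT.
  have [y gy] : exists y, \sum_x W ys x <= C * gain y.
    apply/existsP; apply: contraT; rewrite negb_exists => /forallP no.
    have := tot; rewrite leqNgt; suff -> : \sum_y C * gain y < #|Y| * \sum_x W ys x by [].
    have {}no y : C * gain y < \sum_x W ys x by rewrite ltnNge; apply: no.
    rewrite -sum_nat_const; have /card_gt0P[y yY] := Y0.
    rewrite (bigD1 y) //= [ltnRHS](bigD1 y) //= -addSn leq_add //.
    by apply: leq_sum => z _; apply/ltnW.
  have W0 : 0 < \sum_x W ys x by rewrite (bigD1 x0) //= addn_gt0 expn_gt0.
  have oky : ok ys y.
    by apply: contraTT (leq_trans W0 gy) => /negbTE no; rewrite /gain no big_pred0 // muln0.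
  exists (y :: ys); split; rewrite /= ?sy ?oky //.
  have : \sum_x W (y :: ys) x + gain y = 2 * \sum_x W ys x.
    have -> : gain y = \sum_x (if ab y x then W ys x else 0).
      by rewrite /gain big_mkcond oky.
    rewrite -big_split big_distrr /=; apply: eq_bigr => x _.
    rewrite /W /=; case: (ab y x) => /=.
      by rewrite add0n addnn mul2n.
    by rewrite add1n expnS addn0.
  move: gy hW; rewrite !expnS sy in jm *.
  have C0 : 0 < C by case: (C) hY => // /(_ x0); rewrite mul0n; lia.
  move: (\sum_x W ys x) (gain y) (\sum_x W (y :: ys) x) => a g b hg ha hb.
  have h1 : C * b <= (2 * C).-1 * a by nia.
  apply: leq_trans (_ : (2 * C).-1 * (C ^ j * a) <= _); last by rewrite -mulnA leq_mul2l ha orbT.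
  rewrite mulnAC -mulnA mulnCA; move: h1; rewrite -(leq_pmul2l (_ : 0 < C ^ j)) ?expn_gt0 ?C0 //; lia.
exists ys; split=> // x.
have E : W ys x * 2 ^ count (ab^~ x) ys = 2 ^ m.
  by rewrite /W -expnD addnC count_predC sy.
rewrite expnMn -E mulnC mulnA mulnC -[leqRHS]mulnA leq_mul2l.
apply/orP; right; apply: leq_trans hW; rewrite leq_mul2l (bigD1 x) //= leq_addr orbT //.
Qed.

End Selection.

(** Bernoulli's inequality for [(1 + 1 / D) ^ D]. *)
Lemma two_expD D : 0 < D -> 2 * D ^ D <= D.+1 ^ D.
Proof.
move=> D0; suff H j : D ^ j * (D + j) <= D * D.+1 ^ j.
  by have := H D; rewrite addnn -mul2n mulnA mulnC leq_pmul2l // mulnC.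
elim: j => [|j IH]; first by rewrite addn0 mulnC.
rewrite !expnS; apply: leq_trans (_ : D.+1 * (D ^ j * (D + j)) <= _).
  by move: (D ^ j) => a; nia.
by rewrite [leqRHS]mulnCA leq_mul2l IH orbT.
Qed.

Lemma card_le3 (T : finType) (a b c d : pred T) :
  (forall x, a x -> [|| b x, c x | d x]) -> #|a| <= #|b| + (#|c| + #|d|).
Proof.
move=> hx; rewrite !cardE /enum_mem !size_filter; elim: (Finite.enum T) => //= x s IH.
have := hx x; rewrite !unfold_in.
by case: (a x) => [/(_ isT)|_]; case: (b x); case: (c x); case: (d x); lia.
Qed.

Section Family.

Variables (h : nat) (V : finType) (H : kgraph h.+1 V) (v0 : V).
Hypothesis h0 : 0 < h.
Variables (M K : nat).
Hypotheses (hd : nat_dense H M K) (hg : nat_deg H K) (nh : 2 * h.+1 <= #|V|) (K0 : 0 < K).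
Local Notation n := #|V|.
Local Notation N := (last_pos h).+1.
Local Notation placement := {ffun 'I_(last_pos h).+1 -> V}.
Local Notation A := (absorb_const h K).

Definition used (fs : seq placement) := [set v | has (fun f : placement => v \in codom f) fs].

Lemma card_used fs : #|used fs| <= size fs * N.
Proof.
elim: fs => [|f fs IH] /=.
  by rewrite (eq_card (B := pred0)) ?card0 // => v; rewrite !inE.
have -> : used (f :: fs) = [set v in codom f] :|: used fs.
  by apply/setP => v; rewrite !inE.
apply: leq_trans (leq_card_setU _ _) _; rewrite mulSn leq_add // cardsE.
by apply: leq_trans (card_size _) _; rewrite size_codom card_ord.
Qed.

Definition valid fs (f : placement) :=
  [&& [forall i, f i \notin used fs], injectiveb f & loose_path H (fstart f) (base f)].

(** Let [D] be [4 * A - 1].  By [two_expD], [D] rounds of [weighted_selection]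
    with [C = 2 * A] gain a factor 2, so these rounds gain [2 ^ (2 * q)]: a
    factor [2 ^ q] pays for the number of sets to be absorbed, and the other
    yields [q] absorbers for each of them. *)
Definition family_size q := (4 * A).-1 * (2 * q).

Lemma absorb_const_gt0 : 0 < A.
Proof. by rewrite muln_gt0 !expn_gt0 !muln_gt0 expn_gt0 fact_gt0 K0. Qed.

(** At each round, the placements that overlap earlier absorbers or are not
    injective make up at most half of those counted by [absorber_count]. *)
Lemma absorber_family q : 2 * A <= M -> n ^ h <= 2 ^ q ->
  2 * A * (N * N + N * (N * family_size q)) <= n ->
  exists fs, [/\ size fs = family_size q, chain valid fs &
    forall S : h.-tuple V, q <= count (fun f => fits H v0 f S) fs].
Proof.
move=> hM hq hn; have A0 := absorb_const_gt0; have V0 : 0 < n by lia.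
have x0 : h.-tuple V := [tuple v0 | i < h].
have [||fs [sfs cfs hfs]] := @weighted_selection _ _ (fun (f : placement) (S : h.-tuple V) => fits H v0 f S)
    valid (2 * A) (family_size q) x0.
- by rewrite card_ffun expn_gt0 V0.
- move=> fs sf _ S; rewrite card_ffun card_ord.
  have hA := absorber_count v0 h0 hd hg nh K0 S hM.
  have hU := count_hitting ('I_N) (used fs).
  have hI := count_noninjective ('I_N) V.
  rewrite card_ord in hU hI.
  have cu : #|used fs| <= N * family_size q.
    by apply: leq_trans (card_used fs) _; rewrite mulnC leq_mul2l (ltnW sf) orbT.
  set X := #|[pred f : placement | fits H v0 f S]| in hA.
  set U := #|[pred f : placement | [exists i, f i \in used fs]]| in hU.
  set J := #|[pred f : placement | ~~ injectiveb f]| in hI.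
  set G := #|_|.
  have cov : X <= G + (U + J).
    rewrite /X /G /U /J.
    apply: card_le3 => f; rewrite !inE => ff; rewrite /valid ff (loose_path_base ff) !andbT.
    case: (injectiveb f); rewrite ?orbT //= andbT orbF.
    by rewrite -negb_exists orbC orbN.
  have bad : 2 * A * (U + J) <= n ^ N.
    rewrite -(leq_pmul2l V0).
    apply: leq_trans (_ : 2 * A * (n ^ N * (N * #|used fs| + N * N)) <= _).
      by rewrite mulnCA leq_mul2l (mulnDr n) (mulnDr (n ^ N)) leq_add ?orbT.
    rewrite mulnCA [leqRHS]mulnC leq_mul2l; apply/orP; right.
    apply: leq_trans hn; rewrite leq_mul2l addnC leq_add2l leq_mul2l cu !orbT //.
  nia.
exists fs; split=> // S; have [->//|q0] := posnP q.
have := hfs S; rewrite card_tuple.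
have -> : (2 * (2 * A)).-1 = (4 * A).-1 by lia.
set c := count _ _; set D := (4 * A).-1 => hc.
have D0 : 0 < D by rewrite /D; lia.
have e2 : 2 ^ (2 * q) * D ^ family_size q <= (2 * (2 * A)) ^ family_size q.
  have -> : 2 * (2 * A) = D.+1 by rewrite /D; lia.
  rewrite /family_size -/D !(expnM _ D) -expnMn leq_exp2r ?muln_gt0 //.
  exact: two_expD.
have e3 : 2 ^ (2 * q) <= 2 ^ (c + q).
  have Dm : 0 < D ^ family_size q by rewrite expn_gt0 D0.
  rewrite -(leq_pmul2r Dm); apply: leq_trans e2 (leq_trans hc _).
  by rewrite expnD mulnAC leq_mul2r leq_mul2l hq !orbT.
by move: e3; rewrite leq_exp2l //; lia.
Qed.

End Family.

(** * Short connections *)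

Lemma uniq_reps (T : eqType) (g : seq T -> T) (bs : seq (seq T)) :
  (forall b, b \in bs -> g b \in b) -> uniq (flatten bs) -> uniq (map g bs).
Proof.
elim: bs => //= b bs IH hg; rewrite cat_uniq => /and3P[_ no /IH ->]; last first.
  by move=> a ab; apply: hg; rewrite inE ab orbT.
rewrite andbT; apply/mapP => -[a ab e]; move/hasP: no; apply; exists (g b).
  by rewrite e; apply/flattenP; exists a => //; apply: hg; rewrite inE ab orbT.
by apply: hg; rewrite mem_head.
Qed.

Lemma card_uniq_set (T : finType) (s : seq T) : uniq s -> #|[set v in s]| = size s.
Proof. by move=> us; rewrite cardsE; apply/card_uniqP. Qed.

Lemma card_set_le (T : finType) (s : seq T) : #|[set v in s]| <= size s.
Proof. by rewrite cardsE card_size. Qed.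

Section Connecting.

Variables (h : nat) (V : finType) (H : kgraph h.+1 V).
Hypothesis h0 : 0 < h.
Variables (M K : nat).
Hypothesis hd : nat_dense H M K.
Local Notation n := #|V|.
Local Notation is_edge := (is_edge H).
Local Notation LC := (link_const h K).

Lemma dense_edge l (U W Q : {set V}) : n ^ h.+1 < M * l ^ h.+1 ->
  l <= #|U| -> l <= #|W| -> l <= #|Q| ->
  exists u w q, [/\ u \in U, w \in W, {subset q <= Q}, size q = h.-1 & is_edge [:: u, w & q]].
Proof.
move=> hl lU lW lQ.
pose X := [tuple if (i : nat) == 0 then U else if (i : nat) == 1 then W else Q | i < h.+1].
have hX : M * l ^ h.+1 <= M * \prod_(i < h.+1) #|tnth X i|.
  have -> : l ^ h.+1 = \prod_(i < h.+1) l by rewrite prod_nat_const card_ord.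
  rewrite leq_mul2l; apply/orP; right.
  by apply: leq_prod => i _; rewrite tnth_mktuple; case: ifP => // _; case: ifP.
have : edge_tuples H X != 0.
  apply/eqP => e0; have := leq_trans hl (leq_trans hX (hd X)).
  by rewrite e0 muln0 add0n ltnn.
rewrite -lt0n => /card_gt0P[x]; rewrite inE => /andP[/forallP hx ex].
have nx i v : i < h.+1 -> nth v x i \in (if i == 0 then U else if i == 1 then W else Q).
  by move=> ih; have := hx (Ordinal ih); rewrite tnth_mktuple (tnth_nth v).
have sx := size_tuple x.
case ex' : (tval x) sx => [|u [|w q]] // sx; first by move: sx => /= [] h1; lia.
exists u, w, q; split.
- by have := nx 0 u isT; rewrite ex'.
- by have := nx 1 u; rewrite ex' ltnS; apply.
- move=> v vq; have := nx (index v q).+2 v; rewrite ex' /= nth_index //; apply.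
  by rewrite -sx /= !ltnS index_mem.
- by move: sx => /= [<-].
- by rewrite /is_edge -ex'.
Qed.

Hypotheses (hg : nat_deg H K) (nh : 2 * h.+1 <= #|V|) (K0 : 0 < K).

Lemma link_avoid v (F : {set V}) : LC * (h * #|F|) < n ->
  exists b, [/\ size b = h, is_edge (v :: b) & forall a, a \in b -> a \notin F].
Proof.
move=> hF; have V0 : 0 < n by lia.
have se : size (enum 'I_h) = h by rewrite size_enum_ord.
have := card_sample (fun b => is_edge (v :: b)) (enum_uniq 'I_h) se.
rewrite card_ord => /eqP; rewrite eqn_pmul2l ?expn_gt0 ?V0 // => /eqP e.
have hL := link_count hg nh v; rewrite -e in hL.
have hH := count_hitting ('I_h) F; rewrite card_ord in hH.
set PL := [pred f : {ffun 'I_h -> V} | is_edge (v :: map f (enum 'I_h))] in hL.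
set PB := [pred f : {ffun 'I_h -> V} | [exists i, f i \in F]] in hH.
set L := #|PL| in hL; set B := #|PB| in hH.
have : B < L.
  rewrite ltnNge; apply/negP => LB; move: hF; rewrite ltnNge => /negP; apply.
  have n1 : 0 < n ^ h by rewrite expn_gt0 V0.
  rewrite -(leq_pmul2l n1); apply: leq_trans (leq_mul hL (leqnn n)) _.
  apply: leq_trans (_ : LC * (n * B) <= _).
    by have := leq_mul (leqnn (LC * n)) LB; lia.
  by rewrite [leqRHS]mulnCA leq_mul2l hH orbT.
move=> BL; have /subsetPn[f fL fB] : ~~ (PL \subset PB).
  by apply: contraTN BL => /subset_leq_card; rewrite -leqNgt.
exists (map f (enum 'I_h)); split => [|//|a /mapP[i _ ->]]; first by rewrite size_map.
by move: fB; rewrite inE negb_exists => /forallP/(_ i).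
Qed.

Definition star v (bs : seq (seq V)) := all (fun b => is_edge (v :: b)) bs.

Lemma link_matching v (F : {set V}) l : LC * (h * (#|F| + l * h)) < n ->
  exists bs, [/\ size bs = l, sized h bs, star v bs, uniq (flatten bs) &
    forall a, a \in flatten bs -> a \notin F].
Proof.
elim: l => [|l IH] hl; first by exists [::].
have [|bs [sl sb st ub fb]] := IH.
  by apply: leq_ltn_trans hl; rewrite !leq_mul2l; apply/orP; right; apply/orP; right; nia.
have [|b [szb eb ab]] := @link_avoid v (F :|: [set a in flatten bs]).
  apply: leq_ltn_trans hl; rewrite !leq_mul2l; apply/orP; right; apply/orP; right.
  apply: leq_trans (leq_card_setU _ _) _; rewrite leq_add2l.
  by apply: leq_trans (card_set_le _) _; rewrite (size_sized sb) sl leq_mul2r leqnSn orbT.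
have : uniq (v :: b) by apply: is_edge_uniq eb; rewrite /= szb.
rewrite cons_uniq => /andP[_ ub'].
exists (b :: bs); split; rewrite /= ?sl ?szb ?eqxx ?eb //.
  rewrite cat_uniq ub' ub andbT; apply/hasPn => a af; apply/negP => /ab.
  by rewrite !inE af orbT.
move=> a; rewrite mem_cat => /orP[/ab|/fb //]; by rewrite !inE negb_or => /andP[].
Qed.

(** Take [l] disjoint edges at [x], [l] disjoint edges at [y] and [l] further
    vertices: density provides an edge that meets both families, and three
    edges suffice. *)
Lemma connect x y (F : {set V}) l : n ^ h.+1 < M * l ^ h.+1 ->
  LC * (h * (#|F| + 2 * l * h)) < n -> #|F| + 2 * l * h + l <= n ->
  exists c c', [/\ sized h c && (size c == 3), loose_path H x c, flatten c = rcons c' y, uniq c' &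
    forall a, a \in c' -> a \notin F].
Proof.
move=> hM hl hn.
have [|Mx [slx sbx stx ux fx]] := @link_matching x F l.
  by apply: leq_ltn_trans hl; rewrite !leq_mul2l; apply/orP; right; apply/orP; right; lia.
pose F1 := F :|: [set a in flatten Mx].
have cF1 : #|F1| <= #|F| + l * h.
  apply: leq_trans (leq_card_setU _ _) _; rewrite leq_add2l.
  by apply: leq_trans (card_set_le _) _; rewrite (size_sized sbx) slx.
have [|My [sly sby sty uy fy]] := @link_matching y F1 l.
  by apply: leq_ltn_trans hl; rewrite !leq_mul2l; apply/orP; right; apply/orP; right; lia.
pose F2 := F1 :|: [set a in flatten My].
have cF2 : #|F2| <= #|F| + 2 * l * h.
  apply: leq_trans (leq_card_setU _ _) _.
  have := card_set_le (flatten My); rewrite (size_sized sby) sly; lia.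
have lastin z bs b : sized h bs -> b \in bs -> last z b \in b.
  move=> /allP hb /hb /eqP; case: b => [|a b] /= sz; first by lia.
  by rewrite mem_last.
have headin z bs b : sized h bs -> b \in bs -> head z b \in b.
  move=> /allP hb /hb /eqP; case: b => [|a b] /= sz; first by lia.
  by rewrite mem_head.
have hU : l <= #|[set a in map (last x) Mx]|.
  by rewrite card_uniq_set ?size_map ?slx // uniq_reps // => b; apply: lastin.
have hW : l <= #|[set a in map (head y) My]|.
  by rewrite card_uniq_set ?size_map ?sly // uniq_reps // => b; apply: headin.
have hQ : l <= #|~: F2| by rewrite cardsCs setCK; lia.
have [u [w [q [uU wW qQ sq e]]]] := dense_edge hM hU hW hQ.
move: uU; rewrite inE => /mapP[b1 b1M eu]; move: wW; rewrite inE => /mapP[b2 b2M ew].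
have s1 : size b1 = h by apply/eqP/(allP sbx).
have s2 : size b2 = h by apply/eqP/(allP sby).
have e1 : is_edge (x :: b1) by apply: (allP stx).
have e2 : is_edge (y :: b2) by apply: (allP sty).
have eb2 : b2 = w :: behead b2 by rewrite ew; case: (b2) s2 => //= h1; lia.
have in1 a : a \in b1 -> a \in flatten Mx by move=> ab; apply/flattenP; exists b1.
have in2 a : a \in b2 -> a \in flatten My by move=> ab; apply/flattenP; exists b2.
have : uniq (x :: b1) by apply: is_edge_uniq e1; rewrite /= s1.
rewrite cons_uniq => /andP[_ u1].
have : uniq (y :: b2) by apply: is_edge_uniq e2; rewrite /= s2.
rewrite cons_uniq => /andP[_ u2].
have u3 : uniq [:: u, w & q] by apply: is_edge_uniq e; rewrite /= sq prednK.
exists [:: b1; rcons q w; rcons (behead b2) y], (b1 ++ q ++ b2); split.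
- by rewrite /= s1 !size_rcons sq size_behead s2 prednK ?eqxx.
- rewrite /= e1 last_rcons andbT -eu /=.
  rewrite (@eq_is_edge _ _ H _ [:: u, w & q]) => [|a]; last by rewrite !inE mem_rcons !inE.
  rewrite e /= (@eq_is_edge _ _ H _ (y :: b2)) // => a.
  by rewrite {2}eb2 !inE mem_rcons !inE orbCA.
- rewrite /= cats0 {2}eb2 !rcons_cat /= cat_rcons. by [].
- rewrite !cat_uniq u1 u2 /=; move: u3 => /= /and3P[_ _ ->]; rewrite andbT /=.
  apply/andP; split.
    apply/hasPn => a; rewrite mem_cat => /orP[/qQ|/in2/fy].
      by rewrite !inE !negb_or => /andP[/andP[_ a1] _]; apply: contra a1 => /in1.
    by rewrite !inE negb_or => /andP[_ a1]; apply: contra a1 => /in1.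
  apply/hasPn => a /in2 a2; apply/negP => /qQ; rewrite !inE a2 orbT //.
- move=> a; rewrite !mem_cat => /or3P[/in1/fx //|/qQ|/in2/fy].
    by rewrite !inE !negb_or => /andP[/andP[]].
  by rewrite !inE negb_or => /andP[].
Qed.

End Connecting.

(** * The absorbing path *)

Section Linking.

Variables (h : nat) (V : finType) (H : kgraph h.+1 V) (v0 : V).
Hypothesis h0 : 0 < h.
Variables (M K : nat).
Hypotheses (hd : nat_dense H M K) (hg : nat_deg H K) (nh : 2 * h.+1 <= #|V|) (K0 : 0 < K).
Local Notation n := #|V|.
Local Notation N := (last_pos h).+1.
Local Notation placement := {ffun 'I_(last_pos h).+1 -> V}.
Local Notation LC := (link_const h K).
Implicit Types (f : placement) (fs : seq placement).

Definition start fs := if fs is f :: _ then fstart f else v0.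

Lemma val_at_codom f i : val_at f i \in codom f.
Proof. exact: codom_f. Qed.

Lemma base_codom f a : a \in fstart f :: flatten (base f) -> a \in codom f.
Proof.
rewrite inE flatten_base => /predU1P[->|/mapP[i _ ->]]; exact: val_at_codom.
Qed.

Lemma uniq_base f : injectiveb f -> uniq (fstart f :: flatten (base f)).
Proof.
move=> /injectiveP fi; rewrite flatten_base.
have -> : fstart f :: map (val_at f) (iota h.+1 (base_len h * h))
  = map (val_at f) (0 :: iota h.+1 (base_len h * h)) by [].
rewrite map_inj_in_uniq; first by rewrite cons_uniq mem_iota iota_uniq.
have bd i : i \in 0 :: iota h.+1 (base_len h * h) -> i <= last_pos h.
  by rewrite inE mem_iota last_pos_base => /orP[/eqP ->|]; lia.
by move=> i j /bd il /bd jl /fi e; rewrite -(@inordK (last_pos h) i) // e inordK.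
Qed.

Lemma size_base f : size (flatten (base f)) <= N.
Proof. by rewrite flatten_base size_map size_iota last_pos_base; lia. Qed.

(** [None] leaves the absorber on its base path. *)
Definition request f (o : option (seq V)) :=
  if o is Some s then fits H v0 f s && (size s == h) else true.

Definition absorbing fs x A := forall sg, all2 request fs sg ->
  exists A', [/\ sized h A', loose_path H x A', path_end x A' = path_end x A &
    perm_eq (flatten A') (flatten A ++ flatten (pmap id sg))].

Lemma segment_absorbs f o : request f o -> loose_path H (fstart f) (base f) ->
  exists A', [/\ sized h A', loose_path H (fstart f) A', path_end (fstart f) A' = fend f &
    perm_eq (flatten A') (flatten (base f) ++ flatten (pmap id [:: o]))].
Proof.
move=> ro lb; case: o ro => [S /andP[fS /eqP sS]|_] /=.
  exists (alt v0 f S); split; first exact: sized_blocks.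
  - exact: loose_path_alt.
  - exact: path_end_alt.
  by rewrite cats0 perm_sym perm_catC perm_sym; apply: perm_alt.
exists (base f); rewrite cats0; split=> //; [exact: sized_blocks | exact: path_end_base].
Qed.

(** Every connection avoids all the absorbers and the part of the path already
    built.  An absorber keeps its ends when it takes in a set, so requests to
    different absorbers can be served independently. *)
Lemma link_absorbers l B fs0 fs : fs <> [::] -> chain (valid H) fs ->
  {subset used fs <= used fs0} -> size fs <= size fs0 ->
  size fs0 * (2 * N + 3 * h) < B -> n ^ h.+1 < M * l ^ h.+1 ->
  LC * (h * (B + 2 * l * h)) < n -> B + 2 * l * h + l <= n ->
  exists A, [/\ sized h A && loose_path H (start fs) A, uniq (start fs :: flatten A),
    forall a, a \in start fs :: flatten A -> a \in used fs \/ a \notin used fs0,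
    size (flatten A) <= size fs * (N + 3 * h) & absorbing fs (start fs) A].
Proof.
move=> + + + + hB hM hl hn; elim: fs => [|f [|g fs] IH] // _.
  move=> /andP[/and3P[_ fi fl] _] sub sz; exists (base f); split.
  - by rewrite fl andbT; apply: sized_blocks.
  - exact: uniq_base.
  - by move=> a /base_codom af; left; rewrite inE /= af.
  - by rewrite mul1n (leq_trans (size_base f)) ?leq_addr.
  - move=> [|o [|? ?]] //= => [|/andP[_ ]//]; rewrite andbT => ro.
    have [A' [a b c d]] := segment_absorbs ro fl.
    by exists A'; split=> //; rewrite c path_end_base.
move=> /andP[/and3P[/forallP fu fi fl] cg] sub sz.
have sub' : {subset used (g :: fs) <= used fs0}.
  by move=> a ag; apply: sub; move: ag; rewrite !inE /= => ->; rewrite orbT.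
have ne : g :: fs <> [::] by [].
have [A [/andP[sA lA] uA inA szA abA]] := IH ne cg sub' (ltnW sz).
pose y := fstart g; pose F := used fs0 :|: [set a in y :: flatten A].
have cF : #|F| <= B.
  apply: leq_trans (leq_card_setU _ _) _.
  have := card_set_le (y :: flatten A); have := card_used fs0.
  have : (size fs).+1 * (N + 3 * h) <= size fs0 * (N + 3 * h).
    by rewrite leq_mul2r ltnW ?orbT.
  move: szA; rewrite [size (_ :: flatten A)]/= [size (g :: fs)]/=; lia.
have [||c [c' [/andP[sc /eqP s3] lc fc uc avc]]] :=
  @connect _ _ H h0 _ _ hd hg nh K0 (fend f) y F l hM.
- apply: leq_ltn_trans hl; rewrite !leq_mul2l leq_add2r cF !orbT //.
- by apply: leq_trans hn; rewrite !leq_add2r.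
have szc : size (rcons c' y) = 3 * h by rewrite -fc (size_sized sc) s3.
have ec : path_end (fend f) c = y by rewrite /path_end fc last_rcons.
have fcod a : a \in codom f -> a \in used fs0.
  by move=> af; apply: sub; rewrite inE /= af.
have fav a : a \in codom f -> a \notin used (g :: fs).
  by move=> /codomP[i ->]; apply: fu.
exists (base f ++ c ++ A); split.
- rewrite !sized_cat sc sA sized_blocks /= !loose_path_cat fl /= path_end_base //.
  by apply/andP; split; rewrite ?ec.
- rewrite !flatten_cat fc cat_rcons -cat_cons cat_uniq.
  apply/and3P; split; [exact: uniq_base | | rewrite cat_uniq; apply/and3P; split=> //]; last first.
    by apply/hasPn => a ay; apply/negP => /avc; rewrite !inE; move: ay; rewrite inE => ->; rewrite orbT.
  apply/hasPn => a; rewrite mem_cat => /orP[/avc|/inA au].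
    rewrite inE negb_or => /andP[na _]; apply: contra na => af.
    by apply: fcod; apply: base_codom af.
  apply/negP => /base_codom af; case: au => [|/negP]; last by apply; apply: fcod.
  exact/negP/fav.
- move=> a; rewrite !flatten_cat fc cat_rcons -cat_cons mem_cat.
  move=> /orP[/base_codom af|]; first by left; rewrite inE /= af.
  rewrite mem_cat => /orP[/avc|/inA [ag|]]; [|left|by right].
    by rewrite inE negb_or => /andP[? _]; right.
  by move: ag; rewrite !inE /= => ->; rewrite orbT.
- rewrite !flatten_cat !size_cat fc szc.
  by rewrite addnA [leqRHS]mulSn; apply: leq_add szA; rewrite leq_add2r size_base.
- move=> [|o sg] //= /andP[ro hsg].
  have [A1 [s1 l1 e1 p1]] := abA sg hsg.
  have [A2 [s2 l2 e2 p2]] := segment_absorbs ro fl.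
  exists (A2 ++ c ++ A1); split.
  + by rewrite !sized_cat s1 s2 sc.
  + by rewrite !loose_path_cat l2 e2 lc ec l1.
  + by rewrite !path_end_cat path_end_base // e2 ec e1.
  + have eo : flatten (pmap id (o :: sg)) = flatten (pmap id [:: o]) ++ flatten (pmap id sg).
      by case: (o) => //= s; rewrite cats0.
    rewrite eo !flatten_cat; apply/permP => P; move/permP/(_ P): p1; move/permP/(_ P): p2.
    rewrite !count_cat => -> ->; rewrite -!addnA; congr addn.
    by rewrite addnCA; congr addn; rewrite addnCA.
Qed.

End Linking.

Section Assigning.

Variables (h : nat) (V : finType) (H : kgraph h.+1 V) (v0 : V).
Local Notation placement := {ffun 'I_(last_pos h).+1 -> V}.
Implicit Types fs : seq placement.

Lemma assign_one fs sg s : all2 (request H v0) fs sg -> size s = h ->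
  size (pmap id sg) < count (fun f => fits H v0 f s) fs ->
  exists sg', all2 (request H v0) fs sg' /\ perm_eq (pmap id sg') (s :: pmap id sg).
Proof.
move=> + sh; elim: fs sg => [|f fs IH] [|o sg] //= /andP[ro hsg].
case: o ro => [s1|] /= ro hc.
  have [|sg' [h1 p1]] := IH sg hsg; first by move: hc; case: (fits _ _ _ _); lia.
  exists (Some s1 :: sg'); rewrite /= h1 ro; split=> //.
  rewrite (permPr (_ : perm_eq [:: s, s1 & pmap id sg] [:: s1, s & pmap id sg])) ?perm_cons //.
  by rewrite (perm_catCA [:: s] [:: s1]).
have [fit|nofit] := boolP (fits H v0 f s).
  by exists (Some s :: sg); rewrite /= fit sh eqxx.
have [|sg' [h1 p1]] := IH sg hsg; first by move: hc; rewrite (negbTE nofit).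
by exists (None :: sg').
Qed.

(** When the turn of a set comes, fewer than [q] absorbers are busy, and at
    least [q] can take it in. *)
Lemma assign fs q Ss : (forall S : h.-tuple V, q <= count (fun f => fits H v0 f S) fs) ->
  size Ss <= q -> sized h Ss ->
  exists sg, all2 (request H v0) fs sg /\ perm_eq (pmap id sg) Ss.
Proof.
move=> hq; elim: Ss => [|s Ss IH] /=.
  move=> _ _; exists (nseq (size fs) None); split; first by elim: (fs).
  by elim: (fs).
move=> sq /andP[/eqP sh sS]; have [sg [h1 p1]] := IH (ltnW sq) sS.
have [|sg' [h2 p2]] := assign_one h1 sh.
  by rewrite (perm_size p1); apply: leq_trans sq _; have /eqP ss := sh; apply: (hq (Tuple ss)).
by exists sg'; split=> //; apply: perm_trans p2 _; rewrite perm_cons.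
Qed.

End Assigning.

(** * A long path by depth-first search *)

Section LongPath.

Variables (h : nat) (V : finType) (H : kgraph h.+1 V).
Hypothesis h0 : 0 < h.
Variables (M K : nat).
Hypothesis hd : nat_dense H M K.
Local Notation n := #|V|.
Local Notation is_edge := (is_edge H).

Variables (Y : {set V}) (l : nat).
Hypotheses (l0 : 0 < l) (hM : n ^ h.+1 < M * l ^ h.+1).

Definition dead (D U : {set V}) := forall d q, d \in D -> {subset q <= U} ->
  size q = h -> ~~ is_edge (d :: q).

Lemma card_dead D U : dead D U -> l <= #|U| -> #|D| < l.
Proof.
move=> hDU lU; rewrite ltnNge; apply/negP => lD.
have [u [w [q [uD wU qU sq e]]]] := dense_edge h0 hd hM lD lU lU.
suff : ~~ is_edge [:: u, w & q] by rewrite e.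
apply: hDU => //; last by rewrite /= sq prednK.
by move=> a; rewrite inE => /predU1P[->|/qU].
Qed.

Lemma deadS D (U U' : {set V}) : dead D U -> {subset U' <= U} -> dead D U'.
Proof. by move=> hD sU d q dD qU; apply: hD => // a /qU /sU. Qed.

(** The tip of the path is extended into the unexplored set [U] when possible;
    otherwise it dies and joins [D], its block being dropped from the path.  As
    no edge joins [D] to [U], density keeps [D] small until [U] is small.  The
    [h] vertices of a dropped block are charged to its dead tip in the bound on
    [#|Y|]. *)
Lemma depth_first_search m x bs (D U : {set V}) : 2 * #|U| + size bs <= m ->
  sized h bs -> loose_path H x bs -> uniq (x :: flatten bs) ->
  (forall a, a \in x :: flatten bs -> [/\ a \in Y, a \notin U & a \notin D]) ->
  (forall a, a \in U -> a \in Y /\ a \notin D) ->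
  dead D U -> #|D| < l ->
  #|Y| <= #|U| + (1 + h * size bs) + h * #|D| ->
  exists x' bs', [/\ sized h bs' && loose_path H x' bs', uniq (x' :: flatten bs'),
    {subset x' :: flatten bs' <= Y} & #|Y| <= h * size bs' + 1 + l + h * l].
Proof.
elim: m x bs D U => [|m IH] x bs D U hm sb lb ub hb hU hD Dl cY;
  (have [Ul|lU] := ltnP #|U| l;
   first by exists x, bs; split; rewrite ?sb //; [move=> a /hb[] | nia]).
  by move: hm; lia.
pose e := path_end x bs.
have eb : e \in x :: flatten bs by apply: mem_last.
have [eY eU eD] := hb e eb.
(* First case: the tip [e] can be extended into [U]. *)
have [/existsP[q /andP[/subsetP qU qe]]|no] :=
  boolP [exists q : h.-tuple V, ([set a in q] \subset U) && is_edge (e :: q)].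
  have qU' a : a \in tval q -> a \in U by move=> aq; apply: qU; rewrite inE.
  have := is_edge_uniq _ qe; rewrite /= size_tuple => /(_ erefl) /andP[eq uq].
  have cq : #|[set a in q]| = h by rewrite card_uniq_set ?size_tuple.
  have cU : #|U| = #|U :\: [set a in q]| + h.
    have := cardsID [set a in q] U; rewrite (setIidPr _) ?cq; first lia.
    exact/subsetP.
  apply: (IH x (rcons bs q) D (U :\: [set a in q])).
  - by rewrite size_rcons; lia.
  - by rewrite /sized all_rcons size_tuple eqxx.
  - by rewrite -cats1 loose_path_cat lb /= andbT.
  - rewrite flatten_rcons -cat_cons cat_uniq ub uq andbT.
    apply/hasPn => a /qU' aU; apply/negP => /hb[_ ]; by rewrite aU.
  - move=> a; rewrite flatten_rcons -cat_cons mem_cat => /orP[/hb[aY aU aD]|aq].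
      by split; rewrite // !inE negb_and aU orbT.
    have [aY aD] := hU a (qU' a aq); split=> //; by rewrite !inE aq.
  - by move=> a; rewrite inE => /andP[_ /hU].
  - by apply: deadS hD _ => a; rewrite inE => /andP[].
  - by [].
  - by rewrite size_rcons; nia.
have hD' : dead (e |: D) U.
  move=> d q; rewrite in_setU1 => /predU1P[-> |dD]; last exact: hD.
  move=> qU sq; apply: contraNN no => qe; have /eqP sq' := sq.
  apply/existsP; exists (Tuple sq'); rewrite qe andbT.
  by apply/subsetP => a; rewrite inE; apply: qU.
have cD' : #|e |: D| = #|D|.+1 by rewrite cardsU1 eD.
have D'l : #|e |: D| < l by apply: card_dead hD' lU.
case/lastP: bs => [|bs b] in hm sb lb ub hb cY e eb eY eU eD no hD' cD' D'l *.
  (* The root itself dies, and the search restarts inside [U]. *)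
  have /card_gt0P[x' xU] : 0 < #|U| by lia.
  have cU : #|U| = #|U :\ x'|.+1 by rewrite (cardsD1 x' U) xU.
  have [xY xD] := hU x' xU.
  have xe : x' != e by apply: contraTneq xU => ->.
  apply: (IH x' [::] (e |: D) (U :\ x')) => //=.
  - by rewrite /= in hm; lia.
  - by move=> a; rewrite inE => /eqP ->; rewrite !inE eqxx negb_or xe.
  - move=> a; rewrite !inE => /andP[_ aU]; have [aY aD] := hU a aU; split=> //.
    by rewrite negb_or aD andbT; apply: contraTneq aU => ->.
  - by apply: deadS hD' _ => a; rewrite inE => /andP[].
  - by move: cY; rewrite cD' /=; nia.
have sub a : a \in x :: flatten bs -> a \in x :: flatten (rcons bs b).
  by rewrite flatten_rcons -cat_cons mem_cat => ->.
move: sb lb; rewrite -cats1 sized_cat loose_path_cat => /and3P[sb /eqP szb _] /andP[lb _].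
have ee : e \in b.
  rewrite /e /path_end flatten_rcons last_cat.
  by case: (b) szb => [|a b'] /= hb'; [lia | rewrite mem_last].
have ub' := ub; move: ub'; rewrite flatten_rcons -cat_cons cat_uniq.
move=> /and3P[ub1 /hasPn dis _].
apply: (IH x bs (e |: D) U) => //.
- by move: hm; rewrite size_rcons; lia.
- move=> a ab; have [aY aU aD] := hb a (sub a ab); split=> //.
  rewrite in_setU1 negb_or aD andbT; apply: contraTneq ab => ->.
  exact: dis.
- move=> a aU; have [aY aD] := hU a aU; split=> //.
  by rewrite in_setU1 negb_or aD andbT; apply: contraTneq aU => ->.
- by move: cY; rewrite cD' size_rcons; nia.
Qed.

Lemma long_path : 0 < #|Y| ->
  exists x bs, [/\ sized h bs && loose_path H x bs, uniq (x :: flatten bs),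
    {subset x :: flatten bs <= Y} & #|Y| <= h * size bs + 1 + l + h * l].
Proof.
move=> /card_gt0P[x xY]; apply: (@depth_first_search _ x [::] set0 (Y :\ x) (leqnn _)) => //=.
- by move=> a; rewrite inE => /eqP ->; rewrite !inE eqxx.
- by move=> a; rewrite !inE => /andP[].
- by move=> d q; rewrite inE.
- by rewrite cards0.
- by rewrite cards0 (cardsD1 x Y) xY; lia.
Qed.

End LongPath.

(** * Closing the cycle *)

Lemma uniq_cat_in (T : finType) (X : {set T}) (s t : seq T) : uniq s -> uniq t ->
  {subset s <= X} -> (forall v, v \in t -> v \notin X) -> uniq (s ++ t).
Proof.
move=> us ut sX tX; rewrite cat_uniq us ut andbT; apply/hasPn => v /tX.
by apply: contra => /sX.
Qed.

Lemma last_indep (T : Type) (x y : T) s : 0 < size s -> last x s = last y s.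
Proof. by case: s. Qed.

Section Closing.

Variables (h : nat) (V : finType) (H : kgraph h.+1 V).
Hypothesis h0 : 0 < h.
Variables (M K : nat).
Hypotheses (hd : nat_dense H M K) (hg : nat_deg H K) (nh : 2 * h.+1 <= #|V|) (K0 : 0 < K).
Local Notation n := #|V|.
Local Notation N := (last_pos h).+1.
Local Notation is_edge := (is_edge H).
Local Notation LC := (link_const h K).

Lemma split_last (x z : V) (bs : seq (seq V)) : sized h bs -> z \in map (last x) bs ->
  exists s1 b s2, [/\ bs = s1 ++ b :: s2, path_end x (s1 ++ [:: b]) = z, z \in b & size b = h].
Proof.
move=> sb /mapP[b bb ez]; case/splitPr: bb sb => s1 s2; rewrite sized_cat => /and3P[_ /eqP szb _].
have b0 : 0 < size b by rewrite szb.
exists s1, b, s2; split=> //.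
  by rewrite path_end_cat ez /path_end /= cats0; apply: last_indep.
by rewrite ez; case: (b) b0 => //= c b' _; apply: mem_last.
Qed.

(** The start vertex is listed once, as the last vertex of the last block. *)
Definition block_cycle a (L : seq (seq V)) :=
  [/\ sized h L, loose_path H a L, path_end a L = a, uniq (flatten L) & forall v, v \in flatten L].

(** An upper bound on the number of vertices of the absorbing path. *)
Definition budget l := family_size h K (10 * l) * (2 * N + 3 * h) + 1.

(** Each end of the absorbing path reserves [l] disjoint edges and [l] spare
    vertices.  The long path in the rest is cut into a first stretch of [l]
    blocks, a middle part and a last stretch of [l] blocks.  Density gives an
    edge from the edges reserved at [b] to the end of a block in the first
    stretch, and one from the end of a block in the last stretch to the edges
    reserved at [a].  What is dropped or was never reached fills at most
    [10 * l] blocks, which the absorbing path takes in. *)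
Lemma hamilton_blocks l : 0 < l -> h %| n -> n ^ h.+1 < M * l ^ h.+1 ->
  2 * absorb_const h K <= M -> n ^ h <= 2 ^ (10 * l) ->
  2 * absorb_const h K * (N * N + N * (N * family_size h K (10 * l))) <= n ->
  LC * (h * (budget l + 2 * l * h)) < n -> budget l + 10 * l * h <= n ->
  exists a L, block_cycle a L.
Proof.
move=> l0 hdvd hM hMA h2 hfam hLC hn.
have V0 : 0 < n by lia.
have /card_gt0P[v0 _] := V0.
have lh : l <= l * h by rewrite leq_pmulr.
have [fs [sfs cfs hfs]] := absorber_family v0 h0 hd hg nh K0 hMA h2 hfam.
set q := 10 * l in sfs hfs; set m := family_size h K q in sfs.
have m0 : 0 < m by rewrite /m /family_size /q; have := absorb_const_gt0 h K0; nia.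
have fs0 : fs <> [::] by move=> e; move: sfs; rewrite e /=; lia.
have budm : size fs * (2 * N + 3 * h) < budget l by rewrite /budget addn1 sfs.
have hn1 : budget l + 2 * l * h + l <= n by apply: leq_trans hn; move: (budget l) lh; clear; nia.
have [A [/andP[sA lA] uA _ szA abA]] :=
  link_absorbers v0 h0 hd hg nh K0 fs0 cfs (fun v hv => hv) (leqnn _) budm hM hLC hn1.
set a := start v0 fs in lA uA abA.
pose b := path_end a A.
pose F0 := [set v in a :: flatten A].
have cF0 : #|F0| = (size (flatten A)).+1 by rewrite card_uniq_set.
have cF0B : #|F0| <= budget l.
  rewrite cF0 /budget addn1 ltnS; apply: leq_trans szA _; rewrite sfs leq_mul2l.
  by apply/orP; right; rewrite leq_add2r mul2n -addnn leq_addr.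
have [|Mb [slb sbb stb ub fb]] := @link_matching _ _ H h0 _ hg nh K0 b F0 l.
  apply: leq_ltn_trans hLC; rewrite !leq_mul2l; apply/orP; right; apply/orP; right.
  by apply: leq_add => //; rewrite -mulnA leq_pmull.
pose F1 := F0 :|: [set v in flatten Mb].
have cF1 : #|F1| <= #|F0| + l * h.
  apply: leq_trans (leq_card_setU _ _) _; rewrite leq_add2l.
  by apply: leq_trans (card_set_le _) _; rewrite (size_sized sbb) slb.
have [|Ma [sla sba sta ua fa]] := @link_matching _ _ H h0 _ hg nh K0 a F1 l.
  apply: leq_ltn_trans hLC; rewrite !leq_mul2l; apply/orP; right; apply/orP; right.
  by move: cF1 cF0B; move: (budget l); clear; lia.
pose F2 := F1 :|: [set v in flatten Ma].
have cF2 : #|F2| <= #|F0| + 2 * l * h.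
  apply: leq_trans (leq_card_setU _ _) _.
  have := card_set_le (flatten Ma); rewrite (size_sized sba) sla; move: cF1; clear; lia.
have /card_geqP[s [us ss sF2]] : 2 * l <= #|~: F2|.
  by rewrite cardsCs setCK; move: hn cF2 cF0B lh; move: (budget l); clear; lia.
pose F3 := F2 :|: [set v in s].
have cF3 : #|F3| <= #|F0| + 2 * l * h + 2 * l.
  apply: leq_trans (leq_card_setU _ _) _; by rewrite leq_add // -ss card_set_le.
pose Y := ~: F3.
have cY : n <= #|Y| + (#|F0| + 2 * l * h + 2 * l).
  by rewrite /Y cardsCs setCK; move: cF3 (max_card (mem F3)); clear; lia.
have Y0 : 1 + l + 3 * h * l <= #|Y|.
  by move: hn cY cF0B lh l0; move: (budget l); clear; lia.
have [|x [bs [/andP[sbs lbs] ubs inY szbs]]] := long_path h0 hd l0 hM (Y := Y); first by move: Y0; clear; lia.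
have sz2 : 2 * l <= size bs by rewrite -(leq_pmul2l h0); move: Y0 szbs; clear; lia.
pose B1 := take l bs; pose B2 := take (size bs - 2 * l) (drop l bs).
pose B3 := drop (size bs - 2 * l) (drop l bs).
have eB : bs = B1 ++ (B2 ++ B3) by rewrite !cat_take_drop.
have szB1 : size B1 = l by rewrite size_takel //; move: sz2; clear; lia.
have szB2 : size B2 = size bs - 2 * l by rewrite size_takel // size_drop; move: sz2; clear; lia.
have szB3 : size B3 = l by rewrite !size_drop; move: sz2; clear; lia.
have sB : sized h B1 /\ sized h B3.
  by move: sbs; rewrite {1}eB !sized_cat => /and3P[].
have uB : uniq (flatten B1) /\ uniq (flatten B3).
  move: ubs; rewrite cons_uniq {2}eB !flatten_cat !cat_uniq => /andP[_] /and3P[-> _].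
  by move=> /and3P[_ _ ->].
have lastin z (Bs : seq (seq V)) c : sized h Bs -> c \in Bs -> last z c \in c.
  move=> /allP hb /hb /eqP; case: c => [|d c] /= sz; first by move: h0; rewrite -sz.
  by rewrite mem_last.
have headin z (Bs : seq (seq V)) c : sized h Bs -> c \in Bs -> head z c \in c.
  move=> /allP hb /hb /eqP; case: c => [|d c] /= sz; first by move: h0; rewrite -sz.
  by rewrite mem_head.
have cUb : l <= #|[set v in map (last b) Mb]|.
  by rewrite card_uniq_set ?size_map ?slb // uniq_reps // => c; apply: lastin.
have cUa : l <= #|[set v in map (head a) Ma]|.
  by rewrite card_uniq_set ?size_map ?sla // uniq_reps // => c; apply: headin.
have cZ1 : l <= #|[set v in map (last x) B1]|.
  by rewrite card_uniq_set ?size_map ?szB1 // uniq_reps //; [move=> c; apply: lastin; case: sB | case: uB].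
have cZ3 : l <= #|[set v in map (last x) B3]|.
  by rewrite card_uniq_set ?size_map ?szB3 // uniq_reps //; [move=> c; apply: lastin; case: sB | case: uB].
have cQb : l <= #|[set v in take l s]|.
  by rewrite card_uniq_set ?take_uniq // size_takel // ss; move: (l); clear; lia.
have cQa : l <= #|[set v in drop l s]|.
  by rewrite card_uniq_set ?drop_uniq // size_drop ss; move: (l); clear; lia.
have [u [w [p [uU wZ pQ sp e1]]]] := dense_edge h0 hd hM cUb cZ1 cQb.
have [u' [w' [p' [uU' wZ' pQ' sp' e2]]]] := dense_edge h0 hd hM cUa cZ3 cQa.
rewrite !inE in uU wZ uU' wZ'.
have [s1 [c1 [s2 [eB1 ew wc1 _]]]] := split_last (proj1 sB) wZ.
have [t1 [c3 [t2 [eB3 ew' _ szc3]]]] := split_last (proj2 sB) wZ'.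
case/mapP: uU => b1 b1M eu; case/mapP: uU' => b2 b2M eu'.
have sb1 : size b1 = h by apply/eqP/(allP sbb).
have sb2 : size b2 = h by apply/eqP/(allP sba).
have eb1 : is_edge (b :: b1) by apply: (allP stb).
have eb2 : is_edge (a :: b2) by apply: (allP sta).
have e_b2 : b2 = u' :: behead b2 by rewrite eu'; case: (b2) sb2 => //= h1; move: h0; rewrite -h1.
have [mid midE] : exists mid, mid = s2 ++ B2 ++ t1 ++ [:: c3] by eexists.
have eall : bs = (s1 ++ [:: c1]) ++ mid ++ t2.
  by rewrite eB eB1 eB3 midE -!catA.
have [smid lmid] : sized h mid /\ loose_path H w mid.
  move: sbs lbs; rewrite eall !sized_cat !loose_path_cat => /and3P[_ sm _] /and3P[_ lm _].
  by rewrite -ew.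
have emid : path_end w mid = w'.
  have c30 : 0 < size c3 by rewrite szc3.
  by rewrite -ew' midE !path_end_cat /path_end /= !cats0; apply: last_indep.
have [umid inbs] : uniq (w :: flatten mid) /\ {subset w :: flatten mid <= flatten bs}.
  have ef : flatten bs = flatten s1 ++ (c1 ++ (flatten mid ++ flatten t2)).
    by rewrite eall !flatten_cat /= cats0 -!catA.
  split.
    move: ubs; rewrite cons_uniq ef => /andP[_]; rewrite cat_uniq => /and3P[_ _].
    rewrite cat_uniq has_cat cat_uniq negb_or => /and3P[_ /andP[/hasPn no _] /andP[um _]].
    by rewrite cons_uniq um andbT; apply/negP => /no /negP; apply; exact: wc1.
  move=> v; rewrite ef !mem_cat inE => /predU1P[->|->]; last by rewrite !orbT.
  by rewrite wc1 orbT.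
have inmid v : v \in w :: flatten mid -> v \in Y.
  by move=> /inbs vb; apply: inY; rewrite inE vb orbT.
(* From [b] through [b1] to [u], across to [w], along [mid] to [w'], across to
   [u'], and through [b2] back to [a]. *)
pose tail := [:: b1; rcons p w] ++ mid ++ [:: rcons p' u'; rcons (behead b2) a].
have stail : sized h tail.
  rewrite /tail !sized_cat smid /= !size_rcons sb1 sp sp' size_behead sb2 prednK // eqxx //.
have ltail : loose_path H b tail.
  rewrite /tail loose_path_cat /= eb1 -eu /=.
  rewrite (@eq_is_edge _ _ H _ [:: u, w & p]) => [|v]; last by rewrite !inE mem_rcons !inE.
  rewrite e1 /= /path_end /= cats0 last_cat last_rcons loose_path_cat lmid emid /=.
  rewrite (@eq_is_edge _ _ H _ [:: u', w' & p']) => [|v]; last by rewrite !inE mem_rcons !inE orbCA.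
  rewrite e2 last_rcons andbT /= (@eq_is_edge _ _ H _ (a :: b2)) // => v.
  by rewrite {2}e_b2 !inE mem_rcons !inE orbCA.
have etail : path_end b tail = a.
  by rewrite /tail !path_end_cat /path_end /= !cats0 !last_cat last_rcons.
have ptail : perm_eq (flatten A ++ flatten tail)
    ((a :: flatten A) ++ b1 ++ b2 ++ (p ++ p') ++ (w :: flatten mid)).
  apply/permP => P; rewrite /tail !flatten_cat /= !cats0 !count_cat /= -!cats1 !count_cat /=.
  rewrite {2}e_b2 /=; clear; lia.
have utail : uniq (flatten A ++ flatten tail).
  rewrite (perm_uniq ptail).
  have F01 : {subset F0 <= F1} by apply/subsetP/subsetUl.
  have F12 : {subset F1 <= F2} by apply/subsetP/subsetUl.
  have F23 : {subset F2 <= F3} by apply/subsetP/subsetUl.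
  have no3 v : v \in w :: flatten mid -> v \notin F3 by move/inmid; rewrite in_setC.
  have ins v : v \in p ++ p' -> v \in s.
    rewrite mem_cat => /orP[/pQ|/pQ']; rewrite inE; [exact: mem_take | exact: mem_drop].
  have no2 v : v \in (p ++ p') ++ (w :: flatten mid) -> v \notin F2.
    rewrite mem_cat => /orP[/ins/sF2|/no3]; first by rewrite in_setC.
    by apply: contra; apply: F23.
  have in1 v : v \in b1 -> v \in flatten Mb by move=> vb; apply/flattenP; exists b1.
  have in2 v : v \in b2 -> v \in flatten Ma by move=> vb; apply/flattenP; exists b2.
  have no1 v : v \in b2 ++ (p ++ p') ++ (w :: flatten mid) -> v \notin F1.
    rewrite mem_cat => /orP[/in2/fa //|/no2]; by apply: contra; apply: F12.
  have no0 v : v \in b1 ++ b2 ++ (p ++ p') ++ (w :: flatten mid) -> v \notin F0.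
    rewrite mem_cat => /orP[/in1/fb //|/no1]; by apply: contra; apply: F01.
  have ub1 : uniq b1.
    have : uniq (b :: b1) by apply: is_edge_uniq eb1; rewrite /= sb1.
    by rewrite cons_uniq => /andP[].
  have ub2 : uniq b2.
    have : uniq (a :: b2) by apply: is_edge_uniq eb2; rewrite /= sb2.
    by rewrite cons_uniq => /andP[].
  have up : uniq p.
    have : uniq [:: u, w & p] by apply: is_edge_uniq e1; rewrite /= sp prednK.
    by rewrite !cons_uniq => /and3P[].
  have up' : uniq p'.
    have : uniq [:: u', w' & p'] by apply: is_edge_uniq e2; rewrite /= sp' prednK.
    by rewrite !cons_uniq => /and3P[].
  have upp : uniq (p ++ p').
    apply: (uniq_cat_in (X := [set v in take l s])) => // v /pQ'; rewrite !inE => vd.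
    move: us; rewrite -{1}(cat_take_drop l s) cat_uniq => /and3P[_ /hasPn no _].
    exact: no.
  apply: (uniq_cat_in (X := F0)) => //; last by move=> v vA; rewrite in_set.
  apply: (uniq_cat_in (X := F1)) => //; last by move=> v /in1 vM; apply/setUP; right; rewrite inE.
  apply: (uniq_cat_in (X := F2)) => //; last by move=> v /in2 vM; apply/setUP; right; rewrite inE.
  apply: (uniq_cat_in (X := F3)) => //; by move=> v /ins vs; apply/setUP; right; rewrite inE.
pose rem := enum (~: [set v in flatten A ++ flatten tail]).
have srem : size rem + size (flatten A ++ flatten tail) = n.
  by rewrite -cardE cardsCs setCK card_uniq_set // subnK // -(card_uniqP utail) max_card.
(* [h] divides [n] and the number of vertices in any list of blocks. *)
have [r er] : exists r, size rem = r * h.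
  apply/dvdnP; have : h %| size rem + size (flatten A ++ flatten tail) by rewrite srem.
  by rewrite dvdn_addl // size_cat !(@size_sized h) // -mulnDl dvdn_mull.
have rq : r <= q.
  rewrite -(leq_pmul2r h0) -er.
  have szm : size bs <= size mid + 2 * l by rewrite midE !size_cat szB2; clear; lia.
  have szt : size mid * h <= size (flatten tail).
    by rewrite (size_sized stail) leq_mul2r /tail !size_cat; apply/orP; right; clear; lia.
  have hm : size bs * h <= size mid * h + 2 * l * h by rewrite -mulnDl leq_mul2r szm orbT.
  move: srem; rewrite size_cat /q; move: cY szbs szt hm lh l0; rewrite cF0.
  move: (size bs) (size mid) (size rem) (size (flatten A)) (size (flatten tail)) #|Y| n.
  by clear; lia.
pose Ss := reshape (nseq r h) rem.
have fSs : flatten Ss = rem by rewrite reshapeKr // sumn_nseq er mulnC.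
have sSs : sized h Ss.
  have : shape Ss = nseq r h by rewrite reshapeKl // sumn_nseq er mulnC.
  rewrite /sized => e; rewrite -[all _ _]/(all (preim size (pred1 h)) Ss) -all_map -/(shape _) e.
  exact/all_pred1_nseq.
have szSs : size Ss = r by rewrite size_reshape size_nseq.
have [|sg [hsg psg]] := assign hfs _ sSs; first by rewrite szSs.
have [A' [sA' lA' eA' pA']] := abA sg hsg.
exists a, (A' ++ tail).
have pL : perm_eq (flatten (A' ++ tail)) ((flatten A ++ flatten tail) ++ rem).
  have := perm_flatten psg; rewrite fSs => prem.
  rewrite flatten_cat; apply/permP => P; move/permP/(_ P): pA'; move/permP/(_ P): prem.
  by rewrite !count_cat => -> ->; rewrite addnAC.
split.
- by rewrite sized_cat sA'.
- by rewrite loose_path_cat lA' eA' -/b ltail.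
- by rewrite path_end_cat eA' -/b etail.
- rewrite (perm_uniq pL) cat_uniq utail enum_uniq andbT /=.
  by apply/hasPn => v; rewrite mem_enum !inE.
- move=> v; rewrite (perm_mem pL) mem_cat mem_enum !inE; exact: orbN.
Qed.

End Closing.

(** * From block sequences to Hamilton cycles *)

(** With at least three edges on the cycle, consecutive intervals share only the
    position [i'] at which the second one starts. *)
Lemma consecutive_places i x n h (i' := if i + h == n then 0 else i + h) :
  0 < h -> 3 * h <= n -> i + h <= n -> x < n ->
  ((i <= x <= i + h) || (i + h == n) && (x == 0)) &&
  ((i' <= x <= i' + h) || (i' + h == n) && (x == 0)) = (x == i').
Proof.
by rewrite /i'; case: eqP => e h0 n3 ih xn; apply/idP/idP; lia.
Qed.

Section Conversion.

Variables (h : nat) (V : finType) (H : kgraph h.+1 V).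
Hypothesis h0 : 0 < h.
Local Notation n := #|V|.
Local Notation is_edge := (is_edge H).

Lemma loose_path_window x0 x L j : sized h L -> loose_path H x L -> j < size L ->
  is_edge (map (nth x0 (x :: flatten L)) (iota (j * h) h.+1)).
Proof.
elim: L x j => [|b L IH] // x j /andP[/eqP sb sL] /andP[eb lL] jL.
rewrite [flatten _]/=.
have eb' : x :: b ++ flatten L = belast x b ++ (last x b :: flatten L).
  by rewrite -cat_rcons -lastI.
case: j jL => [|j] jL; last first.
  rewrite mulSn iotaDl -map_comp (eq_map (g := nth x0 (last x b :: flatten L))).
    exact: IH.
  by move=> i; rewrite /= eb' nth_cat size_belast sb ltnNge leq_addr /= addKn.
rewrite mul0n (_ : map _ _ = x :: b) //.
apply: (@eq_from_nth _ x0) => [|i]; rewrite size_map size_iota; first by rewrite /= sb.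
by move=> ih; rewrite (nth_map 0) ?size_iota // nth_iota // -cat_cons nth_cat [size _]/= sb ih.
Qed.

Variables (a : V) (L : seq (seq V)).
Hypothesis cyc : block_cycle H a L.
Hypothesis n3 : 3 * h <= n.

Let w := flatten L.
Let m := size L.
Let s := belast a w.

Lemma size_w : size w = n.
Proof.
case: cyc => _ _ _ uL aL; rewrite -(card_uniqP uL); apply: eq_card => v.
by rewrite !inE aL.
Qed.

Lemma card_blocks : n = m * h.
Proof. by rewrite -size_w (@size_sized h) //; case: cyc. Qed.

Lemma rcons_s : rcons s a = a :: w.
Proof. by case: cyc => _ _ e _ _; rewrite [RHS]lastI; congr rcons. Qed.

Lemma uniq_s : uniq s.
Proof.
have : perm_eq s w by rewrite -(perm_cons a) -rcons_s perm_sym perm_rcons.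
by move/perm_uniq ->; case: cyc.
Qed.

Definition pos (i : 'I_n) : V := nth a s i.

Lemma pos_inj : injective pos.
Proof.
move=> i j /eqP; rewrite nth_uniq ?size_belast ?size_w ?uniq_s //.
by move=> /eqP e; apply: val_inj.
Qed.

(** Positions rather than vertices: [pos] being injective, intersections of
    windows reduce to those of intervals modulo [n]. *)
Definition places (i : 'I_n) : {set 'I_n} := [set iter j (@ordS n) i | j : 'I_h.+1].

Lemma val_iter_ordS (i : 'I_n) j : val (iter j (@ordS n) i) = (i + j) %% n.
Proof.
elim: j => [|j IH] /=; first by rewrite addn0 modn_small.
by rewrite IH -[X in X %% _ = _]addn1 modnDml addn1 addnS.
Qed.

Lemma window_places i : window h.+1 pos i = pos @: places i.
Proof. by rewrite /window /places -imset_comp. Qed.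

Lemma m3 : 3 <= m.
Proof. by move: n3; rewrite card_blocks leq_pmul2r. Qed.

Lemma step_le (i : 'I_n) : h %| i -> i + h <= n.
Proof.
move=> /dvdnP[J eJ]; have := ltn_ord i; rewrite [X in _ < X]card_blocks eJ ltn_mul2r h0 /= => Jm.
by rewrite [X in _ <= X]card_blocks -mulSnr leq_mul2r Jm orbT.
Qed.

Lemma mem_places (i x : 'I_n) : h %| i ->
  (x \in places i) = (i <= x <= i + h) || (i + h == n) && (x == 0 :> nat).
Proof.
move=> hi; have ih := step_le hi; have xn := ltn_ord x; have in_ := ltn_ord i.
apply/imsetP/idP => [[j _ ->]|].
  rewrite val_iter_ordS; have jh := ltn_ord j.
  have [l|l] := ltnP (i + j) n; first by rewrite modn_small //; lia.
  have e : i + j = n by lia.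
  by rewrite e modnn; lia.
case/orP => [/andP[ix xi]|/andP[/eqP e /eqP x0]].
  have l : x - i < h.+1 by lia.
  by exists (Ordinal l) => //; apply: val_inj; rewrite val_iter_ordS /= subnKC // modn_small.
by exists ord_max => //; apply: val_inj; rewrite val_iter_ordS /= e modnn x0.
Qed.

Lemma nth_s i : i <= n -> nth a (a :: w) i = nth a s (i %% n).
Proof.
move=> il; rewrite -rcons_s nth_rcons size_belast size_w.
case: ltngtP il => // [l _|-> _]; first by rewrite modn_small.
by rewrite modnn; rewrite /s; case: (w) size_w.
Qed.

Lemma window_edge (i : 'I_n) : h %| i -> window h.+1 pos i \in edges H.
Proof.
move=> hi; have ih := step_le hi; case/dvdnP: (hi) => J eJ.
have Jm : J < size L.
  by have := ltn_ord i; rewrite [X in _ < X]card_blocks eJ ltn_mul2r => /andP[].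
case: cyc => sL lL _ _ _; have := loose_path_window a sL lL Jm.
rewrite /is_edge (_ : [set y in _] = window h.+1 pos i) //.
apply/setP => y; rewrite inE; apply/mapP/imsetP => [[x]|[j _ ->]].
  rewrite mem_iota -eJ => xi ->; have l : x - i < h.+1 by lia.
  exists (Ordinal l) => //; have ix : i <= x by lia.
  rewrite /pos val_iter_ordS /= subnKC //.
  by rewrite -nth_s //; lia.
have jh := ltn_ord j; exists (i + j); first by rewrite mem_iota -eJ; lia.
by rewrite /pos val_iter_ordS -nth_s //; lia.
Qed.

Definition starts : {set 'I_n} := [set i : 'I_n | h %| i].

Lemma enum_starts : map val (enum starts) = [seq j * h | j <- iota 0 m].
Proof.
have -> : map val (enum starts) = filter (dvdn h) (iota 0 n).
  rewrite -val_enum_ord filter_map; congr map.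
  by rewrite enumT {1}/enum_mem; apply: eq_filter => i; rewrite !inE.
apply: (irr_sorted_eq ltn_trans ltnn).
- by apply: sorted_filter; [exact: ltn_trans | exact: iota_ltn_sorted].
- rewrite sorted_map; apply: sub_sorted (iota_ltn_sorted 0 m) => i j /=.
  by rewrite ltn_mul2r h0.
move=> x; rewrite mem_filter mem_iota /= card_blocks; apply/andP/mapP => [[/dvdnP[J ->]]|[J]].
  by rewrite ltn_mul2r h0 /= => Jm; exists J; rewrite ?mem_iota.
by rewrite mem_iota => Jm ->; rewrite dvdn_mull // ltn_mul2r h0.
Qed.

Lemma card_starts : #|starts| = m.
Proof. by rewrite cardE -(size_map val) enum_starts size_map size_iota. Qed.

Lemma next_iota j : j < m -> next (iota 0 m) j = if j.+1 == m then 0 else j.+1.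
Proof.
move=> jm; rewrite next_nth mem_iota /= jm.
have ij : index j (iota 0 m) = j by rewrite -{1}(add0n j) -(nth_iota 0 0 jm) index_uniq ?iota_uniq ?size_iota.
rewrite ij; case: (m) jm => // m' jm; rewrite [iota _ _]/= eqSS.
by case: eqP => [->|ne]; [rewrite nth_default ?size_iota | rewrite nth_iota ?add1n //; lia].
Qed.

Lemma next_starts (i : 'I_n) : i \in starts ->
  val (next (enum starts) i) = if i + h == n then 0 else i + h.
Proof.
rewrite inE => /dvdnP[J eJ].
have Jm : J < m.
  by have := ltn_ord i; rewrite [X in _ < X]card_blocks eJ ltn_mul2r => /andP[].
rewrite -(next_map val_inj) ?enum_uniq // enum_starts [val i]eJ.
have mh : injective (muln^~ h) by move=> x y /eqP; rewrite eqn_pmul2r // => /eqP.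
rewrite (next_map mh) ?iota_uniq // next_iota //.
rewrite [X in _ + _ == X]card_blocks eJ -mulSnr eqn_pmul2r //.
by case: ifP.
Qed.

Lemma places_next (i : 'I_n) : i \in starts ->
  places i :&: places (next (enum starts) i) = [set next (enum starts) i].
Proof.
move=> iS; set i' := next _ _; have ei' : val i' = _ := next_starts iS.
have hi : h %| i by rewrite inE in iS.
have hi' : h %| i'.
  have : i' \in enum starts by rewrite mem_next mem_enum.
  by rewrite mem_enum inE.
have ih := step_le hi; have n3' := n3.
apply/setP => x; rewrite !inE !mem_places // -val_eqE /=.
by rewrite ei' consecutive_places.
Qed.

Lemma window_inj : {in starts &, injective (window h.+1 pos)}.
Proof.
move=> i j; rewrite !inE => hi hj; rewrite !window_places => /(imset_inj pos_inj) e.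
have ipos : i \in places i by rewrite mem_places //; lia.
have jpos : j \in places j by rewrite mem_places //; lia.
rewrite e mem_places // in ipos; rewrite -e mem_places // in jpos.
apply: val_inj => /=.
case/dvdnP: hi ipos jpos => I eI; case/dvdnP: hj => J eJ.
have := m3; have := card_blocks; rewrite eI eJ => -> m3'.
rewrite -!mulSnr !leq_pmul2r // !eqn_pmul2r // !muln_eq0.
have := h0; case: (h) => // h' _; rewrite !orbF => p1 p2; congr (_ * _); lia.
Qed.

Lemma hamilton_of_blocks : has_hamilton_cycle 1 H.
Proof.
have unif e : e \in [set window h.+1 pos i | i in starts] -> #|e| = h.+1.
  by case/imsetP => i; rewrite inE => hi ->; apply: (edges_uniform (window_edge hi)).
exists (KGraph unif); split; last first.
  by apply/subsetP => e /= /imsetP[i]; rewrite inE => hi ->; apply: window_edge.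
exists pos, starts; split=> //.
- by apply: inj_card_bij pos_inj _; rewrite card_ord.
- move=> i iS; rewrite !window_places -imsetI; last by move=> ? ? _ _; apply: pos_inj.
  by rewrite places_next // imset_set1 cards1.
- by rewrite /= card_in_imset ?card_starts ?subn1 ?card_blocks //; apply: window_inj.
Qed.

End Conversion.

(** * Choice of the constants *)

Section Final.

(** The [h]-th power of [l <= h * 2 ^ (l %/ h)] bounds the left-hand side by
    [2 ^ l] up to the constant [(C * h) ^ h], itself at most [2 ^ l]. *)
Lemma poly_le_exp h C l : 0 < h -> (C * h) ^ h <= l -> (C * l) ^ h <= 2 ^ (10 * l).
Proof.
move=> h0 hl.
have e1 : l <= h * 2 ^ (l %/ h).
  have := ltn_ceil l h0; have := ltn_expl (l %/ h) (isT : 1 < 2); nia.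
apply: leq_trans (_ : (C * h) ^ h * 2 ^ l <= _).
  apply: leq_trans (_ : (C * h * 2 ^ (l %/ h)) ^ h <= _).
    by rewrite leq_exp2r // -mulnA leq_mul2l e1 orbT.
  by rewrite expnMn leq_mul2l -expnM leq_exp2l // leq_trunc_div orbT.
apply: leq_trans (_ : 2 ^ l * 2 ^ l <= _).
  by rewrite leq_mul2r (leq_trans hl) ?orbT // ltnW // ltn_expl.
by rewrite -expnD leq_exp2l //; lia.
Qed.

Variables (h K : nat).
Hypotheses (h0 : 0 < h) (K0 : 0 < K).

(** The scale is [l = n %/ L]: every set in the construction has size at most a
    constant times [l], and [L] is the sum of these constants, so that all of
    them fit.  Sets of size [l] must still span an edge; since [n < 2 * L * l],
    a value of [M] above [(2 * L) ^ h.+1] ensures it. *)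
Lemma hamilton_nat : exists M n0, 0 < M /\ forall (V : finType) (H : kgraph h.+1 V),
  n0 <= #|V| -> h %| #|V| -> nat_dense H M K -> nat_deg H K -> has_hamilton_cycle 1 H.
Proof.
pose A := absorb_const h K; pose N := (last_pos h).+1.
pose LC := link_const h K; pose D := (4 * A).-1 * 20.
pose B := D * (2 * N + 3 * h) + 1.
pose c1 := 2 * A * (N * N + N * (N * D)).
pose c2 := LC * (h * (B + 2 * h)) + 1.
pose c3 := B + 10 * h.
pose L := c1 + c2 + c3.
pose M := (2 * L) ^ h.+1 + 2 * A.
have L0 : 0 < L by rewrite /L /c2; lia.
exists M, (L * ((2 * L * h) ^ h + 1) + 3 * h + 2); split.
  by rewrite /M addn_gt0 expn_gt0 muln_gt0 L0.
move=> V H hn hdvd hd hg; set n := #|V| in hn hdvd.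
pose l := n %/ L.
have lL : L * l <= n by rewrite mulnC leq_trunc_div.
have ll : (2 * L * h) ^ h + 1 <= l.
  by rewrite leq_divRL // mulnC; apply: leq_trans hn; rewrite -addnA leq_addr.
have n3 : 3 * h + 2 <= n by apply: leq_trans hn; rewrite -addnA leq_addl.
have l0 : 0 < l by apply: leq_trans ll; rewrite addn1.
have nl : n < 2 * L * l.
  apply: leq_trans (ltn_ceil n L0) _; rewrite -/l.
  by move: (l) l0 (L); clear; nia.
have fam : family_size h K (10 * l) = D * l.
  by rewrite /family_size /D -/A; move: (4 * A).-1 (l); clear; lia.
have bud : budget h K l <= B * l.
  by rewrite /budget fam /B mulnDl mul1n mulnAC leq_add2l.
have b1 : c1 * l <= n by apply: leq_trans lL; rewrite leq_mul2r /L -addnA leq_addr orbT.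
have b2 : c2 * l <= n by apply: leq_trans lL; rewrite leq_mul2r /L addnAC leq_addl orbT.
have b3 : c3 * l <= n by apply: leq_trans lL; rewrite leq_mul2r /L leq_addl orbT.
have nh : 2 * h.+1 <= n by move: n3 h0; clear; lia.
have [||||||a [Lb cyc]] := hamilton_blocks h0 hd hg nh K0 l0 hdvd.
- apply: leq_trans (_ : (2 * L * l) ^ h.+1 <= _); first by rewrite ltn_exp2r.
  by rewrite expnMn leq_mul2r /M leq_addr orbT.
- by rewrite /M leq_addl.
- apply: leq_trans (_ : (2 * L * l) ^ h <= _); first by rewrite leq_exp2r // ltnW.
  by apply: poly_le_exp => //; apply: leq_trans ll; rewrite addn1.
- rewrite fam -/A -/N; apply: leq_trans b1; rewrite /c1 -[leqRHS]mulnA leq_mul2l.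
  by apply/orP; right; rewrite mulnDl !mulnA leq_add2r leq_pmulr.
- have inner : budget h K l + 2 * l * h <= (B + 2 * h) * l.
    by rewrite mulnDl leq_add // -!mulnA [l * h]mulnC.
  apply: leq_trans b2; rewrite /c2 mulnDl mul1n [leqRHS]addnC.
  apply: leq_trans (_ : l + LC * (h * (budget h K l + 2 * l * h)) <= _).
    by rewrite -[X in X <= _]add1n leq_add2r.
  by rewrite leq_add2l -(mulnA LC) -(mulnA h) !leq_mul2l inner !orbT.
- apply: leq_trans b3; rewrite /c3 mulnDl; apply: leq_add => //.
  by rewrite -!mulnA [l * h]mulnC.
by apply: (hamilton_of_blocks h0 cyc); rewrite -/n (leq_trans _ n3) ?leq_addr.
Qed.

End Final.

(** * From real to integer parameters *)

Import Order.TTheory GRing.Theory Num.Theory.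

Section Transfer.

Variables (R : realType) (h : nat) (V : finType) (H : kgraph h.+1 V).
Local Open Scope ring_scope.

Lemma nat_dense_of_dense (p : R) M K : (0 < M)%N -> (0 < K)%N -> 1 <= K%:R * p ->
  dense p (M * K)%:R^-1 H -> nat_dense H M K.
Proof.
move=> M0 K0 Kp hd X; have := hd X.
set P := \prod_(i < h.+1) #|tnth X i|%:R => hX.
have eP : P = (\prod_(i < h.+1) #|tnth X i|)%N%:R by rewrite natr_prod.
have MK0 : 0 < (M * K)%:R :> R by rewrite ltr0n muln_gt0 M0.
have P0 : 0 <= P by rewrite eP ler0n.
rewrite -(ler_nat R) natrD natrX natrM -eP natrM.
move: hX; rewrite lerBlDr -(ler_pM2l MK0) mulrDr mulVKf ?gt_eqF //.
apply: le_trans; rewrite natrM -mulrA ler_pM2l ?ltr0n //.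
by rewrite mulrA ler_peMl.
Qed.

Lemma min_degree_le v : (min_degree H <= degree H v)%N.
Proof.
rewrite /min_degree; have : v \in index_enum V by rewrite mem_index_enum.
elim: (index_enum V) => //= u s IH; rewrite inE big_cons geq_min.
by case/predU1P => [->|/IH ->]; rewrite ?leqnn ?orbT.
Qed.

Lemma nat_deg_of_mindeg (alpha : R) K : 1 <= K%:R * alpha ->
  alpha * 'C(#|V|, h)%:R <= (min_degree H)%:R -> nat_deg H K.
Proof.
move=> Ka hm v; apply: leq_trans (_ : K * min_degree H <= _)%N; last first.
  by rewrite leq_mul2l min_degree_le orbT.
rewrite -(ler_nat R) natrM.
apply: le_trans (_ : K%:R * (alpha * 'C(#|V|, h)%:R) <= _); last by rewrite ler_wpM2l.
by rewrite mulrA ler_peMl.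
Qed.

End Transfer.

Theorem theorem3 (R : realType) (k : nat) (hk : 2 <= k) (p alpha : R)
    (hp : (0 < p < 1)%R) (halpha : (0 < alpha < 1)%R) :
  exists (n0 : nat) (mu : R), (0 < mu < 1)%R /\
    forall (n : nat) (V : finType) (H : kgraph k V),
      n0 <= n -> k.-1 %| n ->
      dense_mindeg_kgraph n p mu alpha H ->
      has_hamilton_cycle 1 H.
Proof.
case: k hk => [|h] // hk; have h0 : 0 < h by [].
have [p0 _] := andP hp; have [a0 _] := andP halpha.
pose K := maxn (Num.bound p^-1) (Num.bound alpha^-1) + 2.
have big (x : R) : (0 < x)%R -> Num.bound x^-1 <= K -> (1 <= K%:R * x)%R.
  move=> x0 xK; rewrite -ler_pdivrMr // div1r.
  apply: le_trans (ltW (archi_boundP _)) _; first by rewrite invr_ge0 ltW.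
  by rewrite ler_nat.
have Kp : (1 <= K%:R * p)%R by apply: big => //; rewrite /K; lia.
have Ka : (1 <= K%:R * alpha)%R by apply: big => //; rewrite /K; lia.
have K2 : 1 < K by rewrite /K; lia.
have [M [n0 [M0 ham]]] := hamilton_nat h0 (ltnW K2).
exists n0, (M * K)%:R^-1%R; split.
  have MK : 1 < M * K by rewrite (leq_trans K2) // leq_pmull.
  by rewrite invr_gt0 ltr0n (ltnW MK) invf_lt1 ?ltr0n ?ltr1n // ltnW.
move=> n V H hn hdvd [[Vn hd] hm]; rewrite /= in hdvd hm; subst n.
apply: ham => //; first exact: nat_dense_of_dense (ltnW K2) Kp hd.
exact: nat_deg_of_mindeg Ka hm.
Qed.
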